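(* Let $T$ be a tree, let $f:T\to T$ be a continuous map, and let $(\overline{S_H(T)},F)$ be the functional envelope of $(T,f)$. Then: (1) if $h(f)=0$, then $h(F)=0$; (2) if $h(f)>0$, then $h(F)=+\infty$. Here $h$ denotes topological entropy.
   Context: An interval is any space homeomorphic to $[0,1]\subset\mathbb{R}$. A tree is a uniquely arcwise connected space that is either a single point or a union of finitely many intervals; here it is regarded as a metric space with some fixed compatible metric $\rho$. Functional envelope: let $S(T)$ be the set of all continuous maps $T\to T$. Identify each $\varphi\in S(T)$ with its graph in $T\times T$, and let $S_H(T)$ be $S(T)$ endowed with the Hausdorff metric $\rho_H$ applied to graphs, derived from the metric $\rho_{\max}((x_1,y_1),(x_2,y_2))=\max\{\rho(x_1,x_2),\rho(y_1,y_2)\}$ on $T\times T$. Let $\overline{S_H(T)}$ be the closure of $S_H(T)$ in the space of all nonempty closed subsets of $T\times T$ with the Hausdorff metric; it is a compact metric space. The map $\varphi\mapsto f\circ\varphi$ on $S_H(T)$ is uniformly continuous and so extends uniquely to a continuous map $F:\overline{S_H(T)}\to\overline{S_H(T)}$. The system $(\overline{S_H(T)},F)$ is the functional envelope of $(T,f)$. (Equivalently, $\overline{S_H(T)}$ consists of the graphs of all upper semicontinuous set-valued maps $\varphi:T\to T$ with nonempty, connected, compact values, and $F(\varphi)(x)=f(\varphi(x))$.) Topological entropy (Bowen--Dinaburg): for a compact metric space $(X,d)$ and a continuous map $g:X\to X$, put $d^{(n)}(x,y)=\max_{0\le j<n}d(g^j(x),g^j(y))$. A set $E\subseteq X$ is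 $(n,g,\varepsilon)$-separated if $d^{(n)}(x,y)>\varepsilon$ for all distinct $x,y\in E$; let $\mathrm{sep}(n,g,\varepsilon)$ be the maximal cardinality of such a set. Then $h(g)=\lim_{\varepsilon\to0}\limsup_{n\to\infty}\frac1n\log \mathrm{sep}(n,g,\varepsilon)\in[0,+\infty]$. *)

(* Defs.v *)
From HB Require Import structures.
From mathcomp Require Import all_boot all_order all_algebra.
From mathcomp Require Import all_classical all_reals all_analysis.

Set Implicit Arguments.
Unset Strict Implicit.
Unset Printing Implicit Defensive.

Import Order.TTheory GRing.Theory Num.Theory.
Import numFieldNormedType.Exports.

Local Open Scope classical_set_scope.
Local Open Scope ring_scope.

(* Homeomorphism between subspaces [A] and [B]; the values of [f] outside [A]
   and of [g] outside [B] are irrelevant. *)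
Definition homeo_between (X Y : topologicalType) (A : set X) (B : set Y)
    (f : X -> Y) (g : Y -> X) : Prop :=
  [/\ {within A, continuous f}, {within B, continuous g},
      f @` A `<=` B, g @` B `<=` A &
      (forall x, A x -> g (f x) = x) /\ (forall y, B y -> f (g y) = y)].

Definition interval_space (R : realType) (T : topologicalType) (A : set T) :
    Prop :=
  exists (f : R -> T) (g : T -> R), homeo_between (`[0, 1] : set R) A f g.

Definition arc_between (R : realType) (T : topologicalType) (x y : T)
    (A : set T) : Prop :=
  exists (f : R -> T) (g : T -> R),
    [/\ homeo_between (`[0, 1] : set R) A f g, f 0 = x & f 1 = y].

(* The uniqueness is that of the arc as a subset, not of its
   parametrization. *)
Definition uniquely_arcwise_connected (R : realType) (T : topologicalType) :
    Prop :=
  forall x y : T, x <> y -> exists! A : set T, arc_between R x y A.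

Definition tree (R : realType) (T : metricType R) : Prop :=
  [/\ [set: T] !=set0,
      uniquely_arcwise_connected R T &
      (exists x : T, [set: T] = [set x]) \/
      (exists (n : nat) (A : 'I_n -> set T),
         (forall i, interval_space R (A i)) /\
         [set: T] = \bigcup_(i in [set: 'I_n]) A i)].

Lemma tree_compact (R : realType) (T : metricType R) :
  tree T -> compact [set: T].
Proof.
move=> [_ _ [[x ->]|[n [A [Ai ->]]]]]; first exact: compact_set1.
have -> : [set: 'I_n] = [set` enum 'I_n].
  by apply/seteqP; split => i //= _; rewrite mem_enum.
rewrite bigcup_seq; apply: bigsetU_compact => i _.
have [f [g [cf _ fA gA [_ fg]]]] := Ai i.
have <- : f @` (`[0, 1] : set R) = A i.
  apply/seteqP; split => // y Ay; exists (g y); last exact: fg.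
  by apply: gA; exists y.
exact: (continuous_compact cf (@segment_compact _ _ _)).
Qed.

Section prod_metric.
Context {R : realType} {X Y : metricType R}.

Definition mdist_max (p q : X * Y) : R :=
  Num.max (mdist p.1 q.1) (mdist p.2 q.2).

Let mdist_max_ge0 p q : 0 <= mdist_max p q.
Proof. by rewrite le_max mdist_ge0. Qed.

Let mdist_max_positivity p q : mdist_max p q = 0 -> p = q.
Proof.
case: p q => [a b] [c d] /eqP; rewrite eq_le ge_max => /andP[/andP[/= ac bd] _].
by congr pair; apply: mdist_positivity; apply/eqP; rewrite eq_le mdist_ge0 andbT.
Qed.

Let ballEmdist_max p d : ball p d = [set q | mdist_max p q < d].
Proof.
apply/seteqP; split => q /=; rewrite /mdist_max gt_max.
  by move=> [+ +]; rewrite !ballEmdist /= => -> ->.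
by move=> /andP[h1 h2]; split; rewrite ballEmdist.
Qed.

HB.instance Definition _ := @PseudoMetric_isMetric.Build R (X * Y)%type
  mdist_max mdist_max_ge0 mdist_max_positivity ballEmdist_max.

End prod_metric.

Section sub_metric.
Context {R : realType} {X : metricType R} (A : set X).

Let sub_mdist (x y : A) : R := mdist (set_val x) (set_val y).

Let sub_mdist_ge0 x y : 0 <= sub_mdist x y.
Proof. exact: mdist_ge0. Qed.

Let sub_mdist_positivity x y : sub_mdist x y = 0 -> x = y.
Proof. by move/mdist_positivity/val_inj. Qed.

Let ballEsub_mdist (x : A) d : ball x d = [set y | sub_mdist x y < d].
Proof.
have -> : ball x d = set_val @^-1` (ball (set_val x) d) by [].
by rewrite ballEmdist.
Qed.

HB.instance Definition _ := @PseudoMetric_isMetric.Build R (set_type A)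
  sub_mdist sub_mdist_ge0 sub_mdist_positivity ballEsub_mdist.

End sub_metric.

Section hausdorff.
Context {R : realType} {X : metricType R}.
Implicit Types A B C : set X.

Definition hausdorff_bound A B (r : R) : Prop :=
  [/\ 0 <= r,
      forall a, A a -> exists2 b, B b & mdist a b <= r &
      forall b, B b -> exists2 a, A a & mdist a b <= r].

Definition hausdorff_dist A B : R := inf [set r | hausdorff_bound A B r].

Lemma hausdorff_dist_le A B r : hausdorff_bound A B r -> hausdorff_dist A B <= r.
Proof. by move=> h; apply: ge_inf => //; exists 0 => ? []. Qed.

Lemma hausdorff_dist_lt A B e : [set r | hausdorff_bound A B r] !=set0 ->
  hausdorff_dist A B < e -> exists2 r, hausdorff_bound A B r & r < e.
Proof. by move=> h0 /inf_lt; apply. Qed.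

Lemma hausdorff_boundC A B r : hausdorff_bound A B r -> hausdorff_bound B A r.
Proof.
move=> [r0 h1 h2]; split => // a => [/h2|/h1] [b ? ?]; exists b => //;
  by rewrite metric_sym.
Qed.

Lemma hausdorff_bound_trans A B C r s : hausdorff_bound A B r ->
  hausdorff_bound B C s -> hausdorff_bound A C (r + s).
Proof.
move=> [r0 h1 h2] [s0 k1 k2]; split; first exact: addr_ge0.
- move=> a /h1[b /k1[c Cc bc] ab]; exists c => //.
  by rewrite (le_trans (metric_triangle _ b _))// lerD.
- move=> c /k2[b /h2[a Aa ab] bc]; exists a => //.
  by rewrite (le_trans (metric_triangle _ b _))// lerD.
Qed.

Lemma compact_mdist_bounded : compact [set: X] ->
  exists M, forall x y : X, mdist x y <= M.
Proof.
move=> cX; have [X0|/set0P[x0 _]] := eqVneq [set: X] set0.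
  by exists 0 => x; have : [set: X] x by []; rewrite X0.
have cov : \forall M \near +oo, [set: X] `<=` [set x | mdist x0 x <= M].
  move/compact_near_coveringP: cX => /(_ R +oo (fun M x => mdist x0 x <= M)).
  apply=> x _; exists ([set y | mdist x y < 1], [set M | mdist x0 x + 1 <= M]).
    split => /=; last by apply: nbhs_pinfty_ge; rewrite num_real.
    by rewrite -ballEmdist; exact: nbhsx_ballx.
  move=> [y M] /= [xy xM]; apply: le_trans xM.
  by rewrite (le_trans (metric_triangle _ x _))// lerD2l ltW.
have [M hM] := filter_ex cov; exists (M + M) => x y.
rewrite (le_trans (metric_triangle _ x0 _))// lerD//; last exact: hM.
by rewrite metric_sym; exact: hM.
Qed.

Lemma hausdorff_bound_ex A B : compact [set: X] -> A !=set0 -> B !=set0 ->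
  [set r | hausdorff_bound A B r] !=set0.
Proof.
move=> /compact_mdist_bounded[M hM] [a Aa] [b Bb]; exists M; split.
- by rewrite (le_trans (mdist_ge0 a b)).
- by move=> ? _; exists b.
- by move=> ? _; exists a.
Qed.

End hausdorff.

(* The compactness proof is a parameter of the type because it is what makes
   [hausdorff_dist] finite, hence a metric. *)
Record hyperspace (R : realType) (X : metricType R) (cX : compact [set: X]) :=
  Hyperspace {
    hset :> set X ;
    hset_closed : closed hset ;
    hset_nonempty : hset !=set0 }.

Section hyperspace_metric.
Context {R : realType} {X : metricType R} {cX : compact [set: X]}.
Local Notation H := (hyperspace cX).
Implicit Types A B C : H.

HB.instance Definition _ := gen_eqMixin H.
HB.instance Definition _ := gen_choiceMixin H.

Lemma hset_inj : injective (@hset R X cX).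
Proof.
move=> [A cA A0] [B cB B0] /= AB; rewrite AB in cA A0 *.
by rewrite (Prop_irrelevance cA cB) (Prop_irrelevance A0 B0).
Qed.

Let hd A B := hausdorff_dist A B.

Let hd_ltP A B e : hd A B < e -> exists2 r, hausdorff_bound A B r & r < e.
Proof.
by apply: hausdorff_dist_lt; apply: hausdorff_bound_ex => //; exact: hset_nonempty.
Qed.

Let hdxx A : hd A A = 0.
Proof.
apply/eqP; rewrite eq_le; apply/andP; split.
  by apply: hausdorff_dist_le; split => // a Aa; exists a; rewrite ?mdistxx.
by apply: lb_le_inf => [|? []//]; apply: hausdorff_bound_ex => //;
  exact: hset_nonempty.
Qed.

Let hd_sym A B : hd A B = hd B A.
Proof.
rewrite /hd /hausdorff_dist; congr (inf _); by apply/seteqP; split => r; exact: hausdorff_boundC.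
Qed.

Let hd_triangle B A C : hd A C <= hd A B + hd B C.
Proof.
apply/ler_addgt0Pl => e e0; have e20 : 0 < e / 2 by rewrite divr_gt0.
have [|r rAB re] := @hd_ltP A B (hd A B + e / 2); first by rewrite ltrDl.
have [|s sBC se] := @hd_ltP B C (hd B C + e / 2); first by rewrite ltrDl.
apply: le_trans (hausdorff_dist_le (hausdorff_bound_trans rAB sBC)) _.
by apply: le_trans (ltW (ltrD re se)) _; rewrite addrACA -splitr addrC.
Qed.

Let hd_sub A B : hd A B = 0 -> hset A `<=` hset B.
Proof.
move=> AB a Aa; apply: hset_closed => U /nbhs_ballP[e /= e0 aU].
have [|r [_ rAB _] re] := @hd_ltP A B e; first by rewrite AB.
have [b Bb ab] := rAB _ Aa; exists b; split => //; apply: aU.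
by rewrite ballEmdist /=; exact: le_lt_trans re.
Qed.

Let hd_positivity A B : hd A B = 0 -> A = B.
Proof.
move=> AB; apply: hset_inj; apply/seteqP; split; first exact: hd_sub.
by apply: hd_sub; rewrite hd_sym.
Qed.

HB.instance Definition _ := @isMetric.Build R H
  hd hdxx hd_positivity hd_sym hd_triangle.

Lemma hyperspace_mdistE A B : mdist A B = hausdorff_dist A B.
Proof. by []. Qed.

Lemma hyperspace_mdist_lt A B e : mdist A B < e ->
  exists2 r, hausdorff_bound A B r & r < e.
Proof. exact: hd_ltP. Qed.

End hyperspace_metric.

Definition map_graph (X Y : Type) (phi : X -> Y) : set (X * Y) :=
  [set p | p.2 = phi p.1].

Section functional_envelope.
Context {R : realType} {T : metricType R}.

Lemma tree_square_compact : tree T -> compact [set: T * T].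
Proof.
by move=> /tree_compact cT; rewrite -setXTT; exact: compact_setX.
Qed.

Variable hT : tree T.

Local Notation H := (hyperspace (tree_square_compact hT)).

(* A continuous self-map of [T] is identified with its graph; by
   [continuous_graphs_map] none is lost by requiring the graph to be closed. *)
Definition continuous_graphs : set H :=
  [set K | exists2 phi : T -> T, continuous phi & hset K = map_graph phi].

Definition envelope_space : set H := closure continuous_graphs.

Definition envelope_extension (f : T -> T)
    (F : envelope_space -> envelope_space) : Prop :=
  continuous F /\
  (forall (phi : T -> T) (K : envelope_space), continuous phi ->
     hset (set_val K) = map_graph phi ->
     hset (set_val (F K)) = map_graph (f \o phi)).

Lemma map_graph_closed (phi : T -> T) : continuous phi -> closed (map_graph phi).
Proof.
move=> cphi; apply: compact_closed; first exact: metric_hausdorff.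
have -> : map_graph phi = (fun x => (x, phi x)) @` [set: T].
  apply/seteqP; split => [[x y] | _ [x _ <-] //].
  by rewrite /map_graph /= => ->; exists x.
apply: continuous_compact; last exact: tree_compact.
apply: continuous_subspaceT => x.
by apply: cvg_pair => /=; [exact: cvg_id | exact: cphi].
Qed.

Lemma continuous_graphs_map (phi : T -> T) : continuous phi ->
  exists2 K, continuous_graphs K & hset K = map_graph phi.
Proof.
move=> cphi; have [[x0 _] _ _] := hT.
have g0 : map_graph phi !=set0 by exists (x0, phi x0).
by exists (Hyperspace _ (map_graph_closed cphi) g0) => //; exists phi.
Qed.

Lemma tree_unif_continuous (f : T -> T) : continuous f -> forall e, 0 < e ->
  exists2 d, 0 < d & forall x y, mdist x y < d -> mdist (f x) (f y) < e.
Proof.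
move=> cf e e0; have e20 : 0 < e / 2 by rewrite divr_gt0.
have cov : \forall d \near 0^'+,
    [set: T] `<=` [set x | forall y, mdist x y < d -> mdist (f x) (f y) < e].
  move/compact_near_coveringP: (tree_compact hT).
  move=> /(_ R 0^'+
    (fun d x => forall y, mdist x y < d -> mdist (f x) (f y) < e)).
  apply=> x _; have /nbhs_ballP[r /= r0 rU] := cf x _ (nbhsx_ballx (f x) _ e20).
  have r20 : 0 < r / 2 by rewrite divr_gt0.
  exists (ball x (r / 2), [set d | d < r / 2]).
    split => /=; first exact: nbhsx_ballx.
    exact: nbhs_right_lt.
  move=> [z d] /= [xz dr] y zy.
  have xzr : ball x r z by apply: le_ball xz; rewrite ler_pdivrMr// ler_pMr// ler1n.
  have xyr : ball x r y.
    rewrite [r]splitr; apply: ball_triangle xz _.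
    by rewrite ballEmdist /=; exact: lt_trans dr.
  have /= := ball_splitr (rU _ xzr) (rU _ xyr).
  by rewrite ballEmdist.
have [d [d0 hd]] := filter_ex (filterI (nbhs_right_gt 0) cov).
by exists d => // x y; apply: hd.
Qed.

Let post (f : T -> T) (A : set (T * T)) : set (T * T) :=
  (fun p => (p.1, f p.2)) @` A.

Let post_closed f A : continuous f -> closed A -> closed (post f A).
Proof.
move=> cf cA; apply: compact_closed; first exact: metric_hausdorff.
apply: continuous_compact.
  apply: continuous_subspaceT => p; apply: cvg_pair => /=; first exact: cvg_fst.
  apply: (@continuous_comp _ _ _ snd f p); last exact: cf.
  exact: cvg_snd.
exact: subclosed_compact (tree_square_compact hT) _.
Qed.

Let post_graph f phi : post f (map_graph phi) = map_graph (f \o phi).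
Proof.
apply/seteqP; split => [_ [[x y] + <-] | [x y]]; rewrite /map_graph /= => ->//.
by exists (x, phi x).
Qed.

Lemma envelope_extension_exists (f : T -> T) : continuous f ->
  exists F, envelope_extension f F.
Proof.
move=> cf; have post0 (K : H) : post f K !=set0.
  by have [p Kp] := hset_nonempty K; exists (p.1, f p.2), p.
pose P (K : H) : H := Hyperspace _ (post_closed cf (@hset_closed _ _ _ K)) (post0 K).
have cP e : 0 < e ->
    exists2 d, 0 < d & forall K L, mdist K L < d -> mdist (P K) (P L) < e.
  move=> e0; have e20 : 0 < e / 2 by rewrite divr_gt0.
  have [d d0 hd] := tree_unif_continuous cf e20.
  exists (Num.min d (e / 2)); first by rewrite lt_min d0.
  move=> K L /hyperspace_mdist_lt[r [r0 KL LK]]; rewrite lt_min => /andP[rd re].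
  apply: (@le_lt_trans _ _ (e / 2)); last by rewrite ltr_pdivrMr// ltr_pMr// ltr1n.
  have step (p q : T * T) : mdist p q <= r ->
      mdist ((p.1, f p.2) : T * T) ((q.1, f q.2) : T * T) <= e / 2.
    rewrite /mdist /= /mdist_max !ge_max /= => /andP[h1 h2].
    rewrite (le_trans h1 (ltW re)) ltW//; apply: hd; exact: le_lt_trans rd.
  apply: hausdorff_dist_le; split; first exact: ltW.
  - move=> _ [p Kp <-]; have [q Lq pq] := KL _ Kp.
    by exists (q.1, f q.2); [exists q | exact: step].
  - move=> _ [q Lq <-]; have [p Kp pq] := LK _ Lq.
    by exists (p.1, f p.2); [exists p | exact: step].
have PE K : K \in envelope_space -> P K \in envelope_space.
  move=> /set_mem EK; apply/mem_set => U /nbhs_ballP[e /= e0 eU].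
  have [d d0 hd] := cP _ e0.
  have [L [[phi cphi Lphi] KL]] := EK _ (nbhsx_ballx K _ d0).
  exists (P L); split; last first.
    by apply: eU; rewrite ballEmdist /=; apply: hd; move: KL; rewrite ballEmdist.
  exists (f \o phi); first by move=> x; apply: continuous_comp; [exact: cphi|exact: cf].
  by rewrite /= Lphi post_graph.
exists (fun K => exist _ (P (set_val K)) (PE _ (valP K))); split.
  move=> K.
  apply/(@metricType_numDomainType.cvgrPdist_lt _ _ _ _ (nbhs_filter K)) => e e0.
  have [d d0 hd] := cP _ e0.
  have := nbhsx_ballx K _ d0; rewrite ballEmdist.
  apply: (@filterS _ _ (nbhs_filter K)) => L; exact: hd.
by move=> phi K _ Kphi /=; rewrite Kphi post_graph.
Qed.

Lemma envelope_extension_unique (f : T -> T) F G :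
  envelope_extension f F -> envelope_extension f G -> F = G.
Proof.
move=> [cF hF] [cG hG]; apply/funext => K; apply: mdist_positivity.
apply/eqP; rewrite eq_le mdist_ge0 andbT; apply/ler_addgt0Pl => e e0.
have e20 : 0 < e / 2 by rewrite divr_gt0.
have /nbhs_ballP[d1 /= d10 dF] : nbhs K (F @^-1` ball (F K) (e / 2)).
  exact: cF K _ (nbhsx_ballx (F K) _ e20).
have /nbhs_ballP[d2 /= d20 dG] : nbhs K (G @^-1` ball (G K) (e / 2)).
  exact: cG K _ (nbhsx_ballx (G K) _ e20).
pose d := Num.min d1 d2; have d0 : 0 < d by rewrite lt_min d10.
have [L [gL KL]] := set_valP K _ (nbhsx_ballx (set_val K) _ d0).
pose L' : envelope_space := exist _ L (mem_set (subset_closure gL)).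
move: KL; rewrite ballEmdist /= lt_min => /andP[KL1 KL2].
have FL : ball (F K) (e / 2) (F L') by apply: dF; rewrite ballEmdist.
have GL : ball (G K) (e / 2) (G L') by apply: dG; rewrite ballEmdist.
have FG : F L' = G L'.
  have [phi cphi Lphi] := gL; apply: val_inj; apply: hset_inj.
  by rewrite (hF phi L')// (hG phi L').
rewrite FG in FL; have := ball_splitl FL GL.
by rewrite ballEmdist /= addr0 => /ltW.
Qed.

Definition envelope_map (f : T -> T) (cf : continuous f) :
    envelope_space -> envelope_space :=
  sval (cid (envelope_extension_exists cf)).

Lemma envelope_mapP (f : T -> T) (cf : continuous f) :
  envelope_extension f (envelope_map cf).
Proof. exact: svalP. Qed.

End functional_envelope.

Arguments continuous_graphs {R T} hT.
Arguments envelope_space {R T} hT.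
Arguments envelope_extension {R T} hT f F.
Arguments envelope_map {R T} hT {f} cf.

Section entropy.
Context {R : realType} {X : metricType R}.
Implicit Types (g : X -> X) (E : set X) (n : nat) (e : R).

Definition orbit_dist n g (x y : X) : R :=
  \big[Num.max/0]_(j < n) mdist (iter j g x) (iter j g y).

Definition separated n g e E : Prop :=
  forall x y, E x -> E y -> x <> y -> e < orbit_dist n g x y.

(* The space being compact in all uses, the supremum is a finite maximum. *)
Definition sep n g e : \bar R :=
  ereal_sup [set counting E | E in [set E | separated n g e E]].

(* The term of the upper limit at [n = 0] is irrelevant. *)
Definition topological_entropy g : \bar R :=
  lim (limn_esup (fun n => (n%:R^-1)%:E * lne (sep n g e))%E @[e --> 0^'+]).

Lemma sep_ge0 n g e : (0 <= sep n g e)%E.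
Proof.
apply: ereal_sup_ubound => /=; exists set0; first by move=> ? ? [].
by rewrite /counting asboolT ?fset_set0.
Qed.

Lemma le_sep n g e e' : e <= e' -> (sep n g e' <= sep n g e)%E.
Proof.
move=> ee'; apply: ereal_sup_le => _ /= [E sE <-]; exists E => //.
by move=> x y Ex Ey xy; exact: le_lt_trans (sE _ _ Ex Ey xy).
Qed.

Lemma topological_entropy_is_cvg g :
  cvg (limn_esup (fun n => (n%:R^-1)%:E * lne (sep n g e))%E @[e --> (0 : R)^'+]).
Proof.
apply: nonincreasing_at_right_is_cvge; near=> b => x y _ _ xy.
apply: le_ereal_inf_tmp => _ [V FV <-].
apply: le_trans (ereal_inf_lbound _) _; first by exists V.
apply: ge_ereal_sup => _ [n Vn <-]; apply: le_ereal_sup_tmp.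
exists ((n%:R^-1)%:E * lne (sep n g x))%E; first by exists n.
apply: lee_wpmul2l; first by rewrite lee_fin.
by rewrite lee_lne ?le_sep// in_itv /= sep_ge0 leey.
Unshelve. all: by end_near. Qed.

End entropy.

(* Main.v *)
Require Import Defs.
From HB Require Import structures.
From mathcomp Require Import all_boot all_order all_algebra.
From mathcomp Require Import all_classical all_reals all_analysis.
From mathcomp Require Import lra ring zify.

Set Implicit Arguments.
Unset Strict Implicit.
Unset Printing Implicit Defensive.

Import Order.TTheory GRing.Theory Num.Theory.
Import numFieldNormedType.Exports.

Local Open Scope classical_set_scope.
Local Open Scope ring_scope.

(** The two halves have independent proofs, both by counting orbits.

    Positive entropy. A continuous map of the tree can be prescribed to be
    constant, with arbitrary values, on [k] fixed disjoint balls ([platforms]: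
    factor it through a real function and a path). If two such maps take
    distinct values [y], [y'] on one of these balls, then at a time when the
    orbits of [y] and [y'] are [e] apart, the graphs of the iterated maps are
    apart by the minimum of [e] and the radius of the ball. Hence every
    [(n, e)]-separated set with [a] elements yields a separated set of [a ^ k]
    graphs, at a scale that depends on [k] and [e] but not on [n]
    ([sep_envelope_ge]). The entropy of the envelope is at least [k] times
    that of [f], for every [k].

    Zero entropy. A graph is known up to [e] once the images [phi (P)] of
    finitely many small connected pieces [P] of the tree are known, so it
    suffices to show that the orbits of connected sets under [f] take, up to
    [e], subexponentially many shapes during [n] steps.

    The orbits [(f ^ j (K))_(j < n)], for [K] in a family of sets that is
    totally ordered by inclusion, take only linearly many shapes: counting the
    cells of a finite partition that the sets of the orbit meet is a monotone
    function of [K], with values between [0] and [n] times the number of cells,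
    and two sets with the same count meet the same cells at all times
    ([chain_codable]). A connected set through a given point [c] is the union
    of its traces on finitely many arcs issued from [c], and each trace is an
    initial segment of its arc, so its orbit has polynomially many shapes
    ([star_codable]). Now fix a finite set [G] that meets every connected set
    of diameter larger than [e] ([connected_meets_grid]). As long as the images
    of a connected set [K] have diameter at most [e], they follow the orbit of
    any point of [K]; from the first time at which the image is larger, it
    contains a point of [G] and the polynomial bound applies. The number of
    shapes is thus at most a polynomial times the number of separated orbits
    of points ([connected_codable]), which grows subexponentially when [f] has
    entropy zero.

    What makes trees special here is that a connected set contains the arc
    between any two of its points ([connected_seg]). *)

(** * Arcs and their parametrizations *)

Section arcs.
Context {R : realType} {T : metricType R}.
Implicit Types (x y z w : T) (A K : set T) (f g : R -> T) (a b s t : R).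

Lemma continuous_glue f g t : continuous f -> continuous g -> f t = g t ->
  continuous (fun u => if u <= t then f u else g u).
Proof.
move=> cf cg fg u U /= nU.
rewrite /fmap /=; change (\forall v \near u, U (if v <= t then f v else g v)).
have [ut|tu|ut] := ltgtP u t.
- rewrite (ltW ut) in nU; near=> v.
  have -> : v <= t by apply: ltW; near: v; apply: lt_nbhsl.
  by near: v; exact: cf.
- rewrite leNgt tu /= in nU; near=> v.
  have -> : (v <= t) = false.
    by apply/negbTE; rewrite -ltNge; near: v; apply: lt_nbhsr.
  by near: v; exact: cg.
- rewrite ut lexx in nU *.
  have nU' : nbhs (g t) U by rewrite -fg.
  near=> v; case: ifP => _; near: v; [exact: cf|exact: cg].
Unshelve. all: by end_near. Qed.

Definition clamp (b t : R) := Num.max 0 (Num.min t b).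

Lemma clamp_continuous b : continuous (clamp b).
Proof.
move=> t; apply: (@continuous_max _ _ (cst 0) (fun t => Num.min t b)).
  exact: cvg_cst.
apply: (@continuous_min _ _ id (cst b)); [exact: cvg_id|exact: cvg_cst].
Qed.

(** Replaces continuity on the unit interval by continuity on the whole line,
    so that parametrizations can be restricted and concatenated freely. *)
Lemma continuous_clamp f : {within `[0, 1], continuous f} ->
  exists2 g, continuous g & {in `[0, 1], f =1 g}.
Proof.
move=> /subspace_continuousP cf.
have c01 t : `[0, 1]%classic (clamp 1 t).
  by rewrite /= in_itv /= /clamp le_max lexx /= ge_max ler01 ge_min lexx orbT.
exists (f \o clamp 1); last first.
  move=> t; rewrite in_itv /= => /andP[t0 t1].
  by rewrite /= /clamp (min_idPl t1) (max_idPr t0).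
move=> t U nU.
have := cf _ (c01 t) U nU; rewrite /= => h.
have : \forall v \near t, `[0, 1]%classic (clamp 1 v) -> U (f (clamp 1 v)).
  by exact: (clamp_continuous h).
by apply: filterS => v /=; apply; exact: c01.
Qed.

Lemma param_image_closed f a b : continuous f -> closed (f @` `[a, b]).
Proof.
move=> cf; apply: compact_closed; first exact: metric_hausdorff.
apply: continuous_compact; last exact: segment_compact.
exact: continuous_subspaceT.
Qed.

(** Continuity of the inverse of an injective parametrization. By compactness,
    the image of the parameters far from [t0] is closed and misses [f t0]. *)
Lemma param_inverse_near f a b t0 (e : R) : continuous f ->
  {in `[a, b] &, injective f} -> t0 \in `[a, b] -> 0 < e ->
  \forall w \near f t0, forall t, t \in `[a, b] -> f t = w -> `|t0 - t| < e.
Proof.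
move=> cf injf t0ab e0; pose C := `[a, b] `\` ball t0 e.
have cC : closed (f @` C).
  apply: compact_closed; first exact: metric_hausdorff.
  apply: continuous_compact; first exact: continuous_subspaceT.
  apply: compact_closedI; first exact: segment_compact.
  by apply: open_closedC; exact: ball_open.
have : (~` (f @` C)) (f t0).
  move=> [t [tab nb] ft]; apply: nb.
  by rewrite (injf t t0 tab t0ab ft); exact: ballxx.
move=> nC; have /open_nbhs_nbhs := conj (closed_openC cC) nC.
apply: filterS => w wC t tab ftw; apply: contrapT => nlt; apply: wC.
by exists t => //; split.
Qed.

Lemma arc_between_param01 f : continuous f -> {in `[0, 1] &, injective f} ->
  arc_between R (f 0) (f 1) (f @` `[0, 1]).
Proof.
move=> cf injf; pose g w := xget 0 [set t | t \in `[0, 1] /\ f t = w].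
have gP t : t \in `[0, 1] -> g (f t) = t.
  move=> t01; rewrite /g; case: xgetP => [s _ [s01]|/(_ t)].
    exact: injf.
  by case.
exists f, g; split => //; split.
- exact: continuous_subspaceT.
- apply/subspace_continuousP => _ [t0 t001 <-].
  apply/cvgrPdist_lt => e e0; rewrite /= /from_subspace gP//.
  apply: filterS (param_inverse_near cf injf t001 e0) => w h /=.
  by move=> [t t01 tw]; rewrite -tw gP//; exact: h.
- by [].
- by move=> _ [_ [t t01 <-] <-]; rewrite gP.
- by split=> [t /gP //|_ [t t01 <-]]; rewrite gP.
Qed.

Lemma arc_between_param f a b : a < b -> continuous f ->
  {in `[a, b] &, injective f} -> arc_between R (f a) (f b) (f @` `[a, b]).
Proof.
move=> ab cf injf; pose h u := a + u * (b - a).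
have ba0 : 0 < b - a by rewrite subr_gt0.
have hab u : u \in `[0, 1] -> h u \in `[a, b].
  by rewrite !in_itv /= /h => /andP[u0 u1]; apply/andP; split; nra.
have -> : f a = (f \o h) 0 by rewrite /h /= mul0r addr0.
have -> : f b = (f \o h) 1 by rewrite /h /= mul1r addrC subrK.
have -> : f @` `[a, b] = (f \o h) @` `[0, 1].
  apply/seteqP; split => [_ [t tab <-]|_ [u /hab hu <-]]; last by exists (h u).
  exists ((t - a) / (b - a)).
    move: tab; rewrite /= !in_itv /= => tab.
    by rewrite ler_pdivlMr// ler_pdivrMr//; lra.
  by rewrite /h /= divfK ?gt_eqF// addrC subrK.
apply: arc_between_param01.
  move=> u; apply: continuous_comp; last exact: cf.
  by apply: cvgD; [exact: cvg_cst|apply: cvgM; [exact: cvg_id|exact: cvg_cst]].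
move=> u v u01 v01 /= /injf; rewrite !hab// => /(_ isT isT) /addrI.
by apply: mulIf; rewrite gt_eqF.
Qed.

Lemma arc_between_ex x y A : arc_between R x y A -> exists f,
  [/\ continuous f, {in `[0, 1] &, injective f}, f 0 = x, f 1 = y
    & A = f @` `[0, 1]].
Proof.
move=> [f [g [[cf _ fA gA [gK fK]] f0 f1]]].
have [f' cf' ff'] := continuous_clamp cf.
exists f'; split => //.
- move=> s t s01 t01; rewrite -!ff'// => /(congr1 g).
  by rewrite !gK.
- by rewrite -ff'// in_itv /= lexx ler01.
- by rewrite -ff'// in_itv /= lexx ler01.
- apply/seteqP; split => [w Aw|_ [t t01 <-]].
    have gw : `[0, 1]%classic (g w) by apply: gA; exists w.
    by exists (g w) => //; rewrite -ff'// fK.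
  by rewrite -ff'//; apply: fA; exists t.
Qed.

(** Singletons are included as degenerate arcs: [arc_between x x] never holds. *)
Definition seg x y : set T :=
  [set z | z = x \/ exists2 A, arc_between R x y A & A z].

Context (uT : uniquely_arcwise_connected R T).

(** Allowing [a = b] spares all later case distinctions on degenerate arcs. *)
Lemma seg_param f a b : a <= b -> continuous f ->
  {in `[a, b] &, injective f} -> seg (f a) (f b) = f @` `[a, b].
Proof.
rewrite le_eqVlt => /predU1P[<-|ab] cf injf.
  have -> : f @` `[a, a] = [set f a].
    by rewrite set_itv1 image_set1.
  apply/seteqP; split => z /=; last by left.
  move=> [//|[A /arc_between_ex[g [_ ig g0 g1 _]]] _].
  have /ig : g 0 = g 1 by rewrite g0 g1.
  by rewrite !in_itv /= !lexx ler01 => /(_ isT isT) /esym/eqP; rewrite oner_eq0.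
have arcA := arc_between_param ab cf injf.
have aab : a \in `[a, b] by rewrite in_itv /= lexx ltW.
have bab : b \in `[a, b] by rewrite in_itv /= lexx ltW.
have fab : f a <> f b by move=> /(injf _ _ aab bab) /eqP; rewrite lt_eqF.
have [A0 [_ A0u]] := uT fab.
apply/seteqP; split => z; last by move=> fz; right; exists (f @` `[a, b]).
by move=> [->|[A /A0u <-]]; [exists a|rewrite (A0u _ arcA)].
Qed.

Lemma seg_ex x y : exists f b, [/\ 0 <= b, continuous f,
  {in `[0, b] &, injective f}, f 0 = x & f b = y].
Proof.
have [->|/eqP xy] := eqVneq x y.
  exists (cst y), 0; split => //; first by move=> ?; exact: cvg_cst.
  by move=> s t; rewrite !in_itv /= -!eq_le => /eqP <- /eqP <-.
have [A [/arc_between_ex[f [cf injf f0 f1 _]] _]] := uT xy.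
by exists f, 1; split.
Qed.

Lemma seg_l x y : seg x y x. Proof. by left. Qed.

Lemma segxx x : seg x x = [set x].
Proof.
have := @seg_param (cst x) 0 0 (lexx _); rewrite /= => ->.
- by rewrite set_itv1 image_set1.
- by move=> ?; exact: cvg_cst.
- by move=> s t; rewrite !in_itv /= -!eq_le => /eqP <- /eqP <-.
Qed.

Lemma segC x y : seg x y = seg y x.
Proof.
have [f [b [b0 cf injf <- <-]]] := seg_ex x y.
rewrite seg_param//.
have := @seg_param (f \o -%R) (- b) 0; rewrite /= opprK oppr0 => ->.
- apply/seteqP; split => [_ [t tb <-]|_ [t tb <-]]; exists (- t);
    rewrite /= ?opprK//; move: tb; rewrite /= !in_itv /=; lra.
- by rewrite oppr_le0.
- move=> t; apply: continuous_comp; last exact: cf.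
  by apply: cvgN; exact: cvg_id.
- move=> s t; rewrite !in_itv /= => sb tb /injf.
  rewrite !in_itv /= => h; apply: oppr_inj; apply: h; lra.
Qed.

Lemma seg_r x y : seg x y y. Proof. by rewrite segC; exact: seg_l. Qed.

Lemma sub_itv_inj f a b s t : {in `[a, b] &, injective f} -> a <= s -> t <= b ->
  {in `[s, t] &, injective f}.
Proof.
move=> injf sa tb u v us vs; apply: injf; rewrite !in_itv /= in us vs *; lra.
Qed.

Lemma seg_subparam f a b s t : continuous f -> {in `[a, b] &, injective f} ->
  a <= s -> s <= t -> t <= b -> seg (f s) (f t) = f @` `[s, t].
Proof. by move=> cf injf sa st tb; apply/seg_param/sub_itv_inj; eauto. Qed.

(** Follow the arc from [x] to [y] until it first meets the arc from [y] to
    [z], then follow the latter; the result is injective, hence it is the arc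
    from [x] to [z]. *)
Lemma seg_triangle x y z : seg x z `<=` seg x y `|` seg y z.
Proof.
have [f [b [b0 cf injf fx fb]]] := seg_ex x y.
have [g [c [c0 cg injg gy gc]]] := seg_ex y z.
have [Ey Ez] : seg x y = f @` `[0, b] /\ seg y z = g @` `[0, c].
  by rewrite -fx -fb seg_param// -gc fb -gy seg_param.
pose S := `[0, b]%classic `&` f @^-1` (g @` `[0, c]).
have cS : closed S.
  apply: closedI; first exact: interval_closed.
  apply: closed_comp => //; exact: param_image_closed.
have Sb : S b.
  split; first by rewrite /= in_itv /= b0 lexx.
  by exists 0; rewrite /= ?in_itv /= ?lexx // fb.
have hS : has_inf S.
  by split; [exists b|exists 0 => s [/=]; rewrite in_itv /= => /andP[]].
pose p := inf S.
have [pb [q qc gq]] : S p.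
  apply: cS => U /nbhs_ballP[e /= e0 eU].
  have [s Ss sp] := inf_adherent e0 hS; exists s; split => //; apply: eU.
  rewrite /ball /= distrC ger0_norm ?subr_ge0; first by rewrite ltrBlDl.
  by apply: ge_inf => //; case: hS.
have pmin s : s \in `[0, b] -> s < p -> ~ seg y z (f s).
  move=> sb sp; rewrite Ez => gfs; move: sp; rewrite ltNge => /negP; apply.
  by apply: ge_inf; [case: hS|split].
move: pb qc; rewrite /= !in_itv /= => /andP[p0 pb] /andP[q0 qc].
(* If p = 0 or q = c, one of the two pieces of h is a single point; both cannot
   happen unless x = z, and seg_param covers that case too. *)
pose h u := if u <= p then f u else g (u - p + q).
have ch : continuous h.
  apply: continuous_glue => //; last by rewrite subrr add0r.
  move=> u; apply: continuous_comp; last exact: cg.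
  apply: cvgD; last exact: cvg_cst.
  by apply: cvgD; [exact: cvg_id|exact: cvg_cst].
have injh : {in `[0, p + (c - q)] &, injective h}.
  move=> u v; rewrite !in_itv /= /h => ui vi.
  have key s r : s <= p -> p < r -> 0 <= s -> r <= p + (c - q) ->
      f s = g (r - p + q) -> False.
    move=> sp pr s0 rc fs.
    have rI : (r - p + q) \in `[0, c] by rewrite in_itv /=; lra.
    move: sp; rewrite le_eqVlt => /predU1P[sp|sp]; last first.
      apply: (pmin s) => //; first by rewrite in_itv /=; lra.
      by rewrite fs Ez; exists (r - p + q).
    move: fs; rewrite sp -gq => /(injg _ _ _ rI).
    by rewrite in_itv /= q0 qc => /(_ isT); lra.
  case: leP => up; case: leP => vp.
  - by apply: injf; rewrite in_itv /=; lra.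
  - by move=> /key []//; lra.
  - by move=> /esym/key []//; lra.
  - by move=> /injg; rewrite !in_itv /= => h1; apply: (addIr (q - p));
      rewrite addrCA [RHS]addrCA ![q + _]addrC; apply: h1; lra.
have h0 : h 0 = x by rewrite /h p0.
have hc : h (p + (c - q)) = z.
  rewrite /h; case: leP => [qc'|_]; last by rewrite -gc; congr g; lra.
  have -> : p + (c - q) = p by lra.
  by rewrite -gq -gc; congr g; lra.
rewrite -{1}h0 -{1}hc seg_param//; last lra.
move=> _ [u /= ui <-]; rewrite in_itv /= in ui; rewrite Ey Ez /h; case: leP => up.
  by left; exists u => //=; rewrite in_itv /=; lra.
by right; exists (u - p + q) => //=; rewrite in_itv /=; lra.
Qed.

End arcs.

(** * Distances and connectedness *)

Section mdist.
Context {R : realType} {T : metricType R}.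
Implicit Types (x y z : T).

Lemma mdist_ldist x y z : `|mdist x y - mdist x z| <= mdist y z.
Proof.
have := metric_triangle x z y; have := metric_triangle x y z.
by rewrite (metric_sym z y) ler_norml; lra.
Qed.

Lemma mdist_continuous x : continuous (mdist x : T -> R).
Proof.
move=> y; apply/cvgrPdist_lt => e e0.
have := nbhsx_ballx y _ e0; rewrite ballEmdist; apply: filterS => z /=.
exact/le_lt_trans/mdist_ldist.
Qed.

Lemma connected_mdist_ivt (K : set T) x y (r : R) : connected K -> K x -> K y ->
  0 <= r <= mdist x y -> exists2 z, K z & mdist x z = r.
Proof.
move=> cK Kx Ky r0.
have cD : connected (mdist x @` K).
  apply: connected_continuous_connected => //.
  exact/continuous_subspaceT/mdist_continuous.
have D0 : (mdist x @` K) 0 by exists x => //; rewrite mdistxx.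
have Dy : (mdist x @` K) (mdist x y) by exists y.
by have [z Kz <-] := (connected_intervalP _).1 cD _ _ D0 Dy r r0; exists z.
Qed.

Lemma segment_unif_continuous (f : R -> T) a b (e : R) : continuous f -> 0 < e ->
  exists2 d, 0 < d & forall s t, s \in `[a, b] -> `|s - t| < d ->
    mdist (f s) (f t) < e.
Proof.
move=> cf e0; have e20 : 0 < e / 2 by rewrite divr_gt0.
have cov : \forall d \near 0^'+,
    `[a, b] `<=` [set s | forall t, `|s - t| < d -> mdist (f s) (f t) < e].
  move/compact_near_coveringP: (@segment_compact R a b).
  move=> /(_ R 0^'+
    (fun d s => forall t, `|s - t| < d -> mdist (f s) (f t) < e)).
  apply=> s _; have /nbhs_ballP[r /= r0 rU] := cf s _ (nbhsx_ballx (f s) _ e20).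
  have r20 : 0 < r / 2 by rewrite divr_gt0.
  exists (ball s (r / 2), [set d | d < r / 2]).
    split => /=; first exact: nbhsx_ballx.
    exact: nbhs_right_lt.
  move=> [u d] /= [su dr] t ut.
  have sur : ball s r u by apply: le_ball su; lra.
  have str : ball s r t.
    rewrite [r]splitr; apply: ball_triangle su _.
    exact: lt_trans dr.
  have /= := ball_splitr (rU _ sur) (rU _ str).
  by rewrite ballEmdist.
have [d [d0 hd]] := filter_ex (filterI (nbhs_right_gt 0) cov).
by exists d => // s t sI; apply: hd.
Qed.

End mdist.

(** * Counting by codes *)

Section codable.

(** [S] splits into at most [N] classes within each of which [r] holds. Stated
    with labels in a finite type, such bounds multiply under finite
    conjunctions of relations. *)
Definition codable (X : Type) (S : set X) (r : X -> X -> Prop) (N : nat) : Prop :=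
  exists c : X -> 'I_N, forall x y, S x -> S y -> c x = c y -> r x y.

Lemma codable_finType (X : Type) (J : finType) (c : X -> J) (S : set X) r N :
  (forall x y, S x -> S y -> c x = c y -> r x y) -> (#|J| <= N)%N ->
  codable S r N.
Proof.
move=> cr JN; exists (fun x => widen_ord JN (enum_rank (c x))) => x y Sx Sy.
by move=> /(congr1 val) /= /val_inj /enum_rank_inj; exact: cr.
Qed.

Lemma codable_sub (X : Type) (S S' : set X) (r r' : X -> X -> Prop) N :
  S' `<=` S -> (forall x y, S' x -> S' y -> r x y -> r' x y) ->
  codable S r N -> codable S' r' N.
Proof.
move=> S'S rr' [c cP]; exists c => x y S'x S'y cxy; apply: rr' => //.
by apply: cP => //; exact: S'S.
Qed.

Lemma codable_preimage (X Y : Type) (g : X -> Y) (S : set Y) r N :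
  codable S r N -> codable (g @^-1` S) (fun x y => r (g x) (g y)) N.
Proof. by move=> [c cP]; exists (c \o g) => x y; exact: cP. Qed.

Lemma codable_forall (X : Type) (I : finType) (S : set X)
    (r : I -> X -> X -> Prop) N :
  (forall i, codable S (r i) N) ->
  codable S (fun x y => forall i, r i x y) (N ^ #|I|).
Proof.
move=> /choice[c cP].
apply: (@codable_finType _ {ffun I -> 'I_N} (fun x => [ffun i => c i x])).
  by move=> x y Sx Sy /ffunP cxy i; apply: cP => //; have := cxy i; rewrite !ffunE.
by rewrite card_ffun card_ord.
Qed.

Lemma codable_imply (X : Type) (A S : set X) r N : codable (S `&` A) r N ->
  codable S (fun x y => A x -> r x y) N.+1.
Proof.
move=> [c cP].
apply: (@codable_finType _ (option 'I_N)
  (fun x => if pselect (A x) then Some (c x) else None)).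
  move=> x y Sx Sy; case: pselect => [Ax|//]; case: pselect => // Ay [cxy] _.
  exact: cP.
by rewrite card_option card_ord.
Qed.

End codable.

(** * Orbits of sets *)

Section trajectories.
Context {R : realType} {T : metricType R} (f : T -> T).
Implicit Types (K L : set T) (e : R) (n : nat).

Definition traj_close n e K L : Prop :=
  forall j, (j < n)%N -> hausdorff_bound (iter j f @` K) (iter j f @` L) e.

Lemma hausdorff_boundU (X : Type) (g : X -> T) (I : Type) (K L : I -> set X) e :
  0 <= e -> (forall i, hausdorff_bound (g @` K i) (g @` L i) e) ->
  hausdorff_bound (g @` \bigcup_i K i) (g @` \bigcup_i L i) e.
Proof.
move=> e0 h; split=> //.
- move=> _ [x [i _ Kx] <-]; have [_ /(_ (g x)) + _] := h i.
  case; first by exists x.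
  by move=> _ [y Ly <-] gxy; exists (g y) => //; exists y => //; exists i.
- move=> _ [x [i _ Kx] <-]; have [_ _ /(_ (g x))] := h i.
  case; first by exists x.
  by move=> _ [y Ly <-] gxy; exists (g y) => //; exists y => //; exists i.
Qed.

Section cells.
Context (J : finType) (q : T -> J) (e : R).
Context (e_ge0 : 0 <= e) (q_close : forall x y, q x = q y -> mdist x y <= e).

(** The number of cells met at time [j] increases with the set. Hence, if [K] is
    contained in [L] and the totals over all times agree, then [f ^ j (K)] and
    [f ^ j (L)] meet the same cells at each time. *)
Lemma chain_codable n (S : set (set T)) :
  (forall K L, S K -> S L -> K `<=` L \/ L `<=` K) ->
  codable S (traj_close n e) (n * #|J|).+1.
Proof.
move=> chainS.
pose cells K (j : 'I_n) : {set J} :=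
  
  finset (fun c => `[< exists2 x, K x & q (iter j f x) = c >]).
pose code K := (\sum_(j < n) #|cells K j|)%N.
have code_lt K : (code K < (n * #|J|).+1)%N.
  have -> : (n * #|J|)%N = (\sum_(j < n) #|J|)%N by rewrite sum_nat_const card_ord.
  by rewrite ltnS; apply: leq_sum => j _; exact: max_card.
exists (fun K => Ordinal (code_lt K)).
have main K L : K `<=` L -> code K = code L -> traj_close n e K L.
  move=> KL /eqP cKL.
  have sub j : cells K j \subset cells L j.
    apply/fintype.subsetP => c; rewrite !finset.inE => /asboolP[x Kx <-].
    by apply/asboolP; exists x => //; exact: KL.
  have lif := leqif_sum (fun j (_ : true) => subset_leqif_cards (sub j)).
  move: cKL; rewrite /code lif => /forallP eqc.
  move=> j jn; split => //.
    move=> _ [x Kx <-]; exists (iter j f x); last by rewrite mdistxx.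
    by exists x => //; exact: KL.
  move=> _ [x Lx <-].
  have : q (iter j f x) \in cells L (Ordinal jn).
    by rewrite finset.inE; apply/asboolP; exists x.
  have /eqP <- := eqc (Ordinal jn).
  rewrite finset.inE => /asboolP[y Ky yx]; exists (iter j f y); first by exists y.
  exact: q_close.
move=> K L SK SL /(congr1 val) /= cKL.
have [KL|LK] := chainS _ _ SK SL; first exact: main.
by move=> j jn; apply/hausdorff_boundC/main.
Qed.

End cells.
End trajectories.

Lemma iter_continuous (X : topologicalType) (f : X -> X) n :
  continuous f -> continuous (iter n f).
Proof.
move=> cf; elim: n => [|n IH] x; first exact: cvg_id.
exact: (continuous_comp (IH x) (cf _)).
Qed.

Lemma image_iterD (X : Type) (f : X -> X) (A : set X) i j :
  iter (i + j) f @` A = iter i f @` (iter j f @` A).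
Proof.
rewrite image_comp; congr (_ @` A).
by apply/funext => x; rewrite /= iterD.
Qed.

(** * Uniquely arcwise connected finite unions of arcs *)

Section finite_union_of_arcs.
Context {R : realType} {T : metricType R} (uT : uniquely_arcwise_connected R T).
Context (m : nat) (F : 'I_m -> R -> T) (B : 'I_m -> R).
Context (B_ge0 : forall i, 0 <= B i) (F_continuous : forall i, continuous (F i)).
Context (F_inj : forall i, {in `[0, B i] &, injective (F i)}).
Context (F_cover : forall x, exists i, exists2 t, t \in `[0, B i] & F i t = x).
Implicit Types (x y z w : T) (K : set T).

Lemma seg_subarc i s t : s \in `[0, B i] -> t \in `[0, B i] ->
  seg (F i s) (F i t) = F i @` `[Num.min s t, Num.max s t].
Proof.
rewrite !in_itv /= => sB tB; case: (leP s t) => st.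
  by apply: (seg_subparam uT (@F_continuous i) (@F_inj i)); lra.
rewrite segC//; apply: (seg_subparam uT (@F_continuous i) (@F_inj i)); lra.
Qed.

(** Local arcwise connectedness. Points close to [w] lie on an arc of the
    family through [w], and on such an arc a point close to [w] has its
    parameter closer to that of [w] than the parameter of [z] is. *)
Lemma seg_avoid_near z w : z <> w -> \forall w' \near w, ~ seg w w' z.
Proof.
move=> zw.
have H i : \forall w' \near w,
    (exists2 t, t \in `[0, B i] & F i t = w') -> ~ seg w w' z.
  have [[t0 t0B wE]|nw] := pselect ((F i @` `[0, B i]) w); last first.
    have := open_nbhs_nbhs
      (conj (closed_openC (@param_image_closed _ _ _ 0 (B i) (@F_continuous i))) nw).
    by apply: filterS => w' nw' /= [t tB tw]; case: nw'; exists t.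
  have [[tz tzB zE]|nz] := pselect ((F i @` `[0, B i]) z); last first.
    near=> w' => -[t tB <-]; rewrite -wE seg_subarc// => -[s /= sI sz].
    apply: nz; exists s => //; move: t0B tB sI.
    rewrite /= !in_itv /= ge_min le_max; lra.
  have tt0 : 0 < `|t0 - tz|.
    by rewrite normr_gt0 subr_eq0; apply/eqP => E; apply: zw; rewrite -zE -wE E.
  rewrite -wE.
  apply: filterS (param_inverse_near (@F_continuous i) (@F_inj i) t0B tt0).
  move=> w' h [t tB tw]; have {}h := h t tB tw.
  rewrite -tw seg_subarc// => -[s /= sI sz].
  have sB : s \in `[0, B i].
    by move: t0B tB sI; rewrite /= !in_itv /= ge_min le_max; lra.
  have E : s = tz by apply: F_inj sB tzB _; rewrite sz zE.
  rewrite {}E {sz sB} in sI.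
  move: sI h tt0; clear; rewrite in_itv /= ge_min le_max.
  have [?|?] := lerP t0 tz; have [?|?] := lerP t0 t; move=> sI h tt0;
    move: sI => /andP[/orP[?|?] /orP[?|?]]; lra.
have := filter_forall (nbhs_filter w) H; apply: filterS => w' h.
by have [i hi] := F_cover w'; exact: h i hi.
Unshelve. all: by end_near. Qed.

(** If [z] lies on the arc from [x] to [y], then the sets of points [w] whose
    arc from [x] avoids, respectively contains, [z] are both open away from
    [z]. A connected set that contains [x] and [y] but not [z] would be
    separated by them. *)
Lemma connected_seg K x y : connected K -> K x -> K y -> seg x y `<=` K.
Proof.
move=> cK Kx Ky z sz; apply: contrapT => nKz.
pose U : set T := [set w | ~ seg x w z].
have near_eq w : K w -> \forall w' \near w, U w <-> U w'.
  move=> Kw; have zw : z <> w by move=> E; apply: nKz; rewrite E.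
  apply: filterS (seg_avoid_near zw) => w' nz; split=> nU sU.
    by have [] := seg_triangle uT w sU.
  by have [|] := seg_triangle uT w' sU => //; rewrite segC.
have UK w : K w -> U w -> interior U w.
  by move=> Kw Uw; apply: filterS (near_eq w Kw) => w' [h _]; exact: h.
have CK w : K w -> ~ U w -> interior (~` U) w.
  by move=> Kw Uw; apply: filterS (near_eq w Kw) => w' [_ h] /h.
have Ux : U x by rewrite /U /= segxx// => zx; apply: nKz; rewrite zx.
have KU : K `&` interior U = K.
  apply: cK.
  - by exists x; split => //; exact: UK.
  - by exists (interior U) => //; exact: open_interior.
  - exists (~` interior (~` U)); first exact/open_closedC/open_interior.
    apply/seteqP; split => w [Kw wU]; split => //.
      by move=> /interior_subset; apply; exact: interior_subset.
    by apply: UK => //; apply: contrapT => /(CK _ Kw).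
by move: Ky; rewrite -KU => -[_ /interior_subset]; apply.
Qed.

(** An arc of the family is contained in the union of the two arcs from [c] to
    its ends. *)
Lemma star_cover c x : exists i : 'I_m * bool,
  seg c (F i.1 (if i.2 then B i.1 else 0)) x.
Proof.
have [i [t tB <-]] := F_cover x.
have : seg (F i 0) (F i (B i)) (F i t) by rewrite seg_param//; exists t.
move/(seg_triangle uT c) => [h|h]; last by exists (i, true).
by exists (i, false); rewrite segC.
Qed.

(** Each of the two traces on the arc from [c] to [e] is an initial segment. *)
Lemma seg_initial_total c e K L : connected K -> connected L -> K c -> L c ->
  K `&` seg c e `<=` L \/ L `&` seg c e `<=` K.
Proof.
move=> cK cL Kc Lc; have [f [b [b0 cf injf fc fb]]] := seg_ex uT c e.
have segE s t : 0 <= s -> s <= t -> t <= b -> seg c (f t) (f s).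
  move=> s0 st tb; rewrite -fc (seg_subparam uT cf injf)//; last lra.
  by exists s => //=; rewrite in_itv /=; lra.
have [|nKL] := pselect (K `&` seg c e `<=` L); first by left.
right; move: nKL => /existsNP[x /not_implyP[[Kx sx] nLx]] y [Ly sy].
rewrite -fc -fb seg_param// in sx sy; case: sx sy => s sI xE [t tI yE].
rewrite /= !in_itv /= in sI tI.
have [ts|st] := leP t s.
  apply: (connected_seg cK Kc Kx); rewrite -xE -yE; apply: segE; lra.
case: nLx; apply: (connected_seg cL Lc Ly); rewrite -xE -yE; apply: segE; lra.
Qed.

(** ** Meshes *)

Lemma uniform_mesh (e : R) : 0 < e -> exists2 N, (0 < N)%N &
  forall i s t, s \in `[0, B i] -> `|s - t| <= B i / N%:R ->
    mdist (F i s) (F i t) < e.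
Proof.
move=> e0.
have H i : \forall N \near \oo, forall s t, s \in `[0, B i] ->
    `|s - t| <= B i / N%:R -> mdist (F i s) (F i t) < e.
  have [d d0 hd] := segment_unif_continuous 0 (B i) (@F_continuous i) e0.
  near=> N => s t sB st; apply: hd => //; apply: le_lt_trans st _.
  have N0 : (0 < N)%N by near: N; exact: nbhs_infty_gt.
  rewrite ltr_pdivrMr ?ltr0n// mulrC -ltr_pdivrMr//.
  by near: N; exact: nbhs_infty_gtr.
have [N [N0 hN]] := filter_ex (filterI (nbhs_infty_gt 0) (filter_forall _ H)).
by exists N.
Unshelve. all: by end_near. Qed.

Lemma small_connected_cover (e : R) : 0 < e ->
  exists (J : finType) (P : J -> set T),
    [/\ forall j, connected (P j) /\ P j !=set0,
        forall j x y, P j x -> P j y -> mdist x y <= e &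
        forall x, exists j, P j x].
Proof.
move=> e0; have [N N0 hN] := uniform_mesh e0.
have NR : (0 : R) < N%:R by rewrite ltr0n.
pose h i := B i / N%:R.
pose cell i k := `[h i * k%:R, Num.min (B i) (h i * k.+1%:R)]%R.
exists ('I_m * 'I_N.+1)%type,
  (fun j : 'I_m * 'I_N.+1 => F j.1 @` [set` cell j.1 j.2]); split.
- move=> [i k]; split.
    apply: connected_continuous_connected; first exact: segment_connected.
    exact: continuous_subspaceT.
  have h0 : 0 <= h i by rewrite divr_ge0// ltW.
  have hB : h i * N%:R = B i by rewrite divfK// gt_eqF.
  exists (F i (h i * k%:R)), (h i * k%:R) => //=.
  by rewrite in_itv /= lexx le_min -{1}hB !ler_wpM2l// ler_nat// -ltnS.
- move=> [i k] _ _ [s /= sc <-] [t /= tc <-]; apply/ltW/hN.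
    move: sc; rewrite !in_itv /= le_min.
    have : 0 <= h i * k%:R by rewrite mulr_ge0// divr_ge0// ltW.
    lra.
  move: sc tc; rewrite !in_itv /= !le_min -/(h i) -natr1 mulrDr mulr1 ler_norml.
  lra.
- move=> x; have [i [t tB <-]] := F_cover x.
  move: (tB); rewrite in_itv /= => /andP[t0 tBi].
  have h0 : 0 <= h i by rewrite divr_ge0// ltW.
  have hB : h i * N%:R = B i by rewrite divfK// gt_eqF.
  have hi0 : h i = 0 \/ 0 < h i.
    by have [->|hn] := eqVneq (h i) 0; [left|right; rewrite lt_neqAle eq_sym hn].
  have /andP[k1 k2] := Num.Theory.truncn_itv (divr_ge0 t0 h0).
  have kN : (Num.truncn (t / h i) < N.+1)%N.
    rewrite ltnS -(ler_nat R); apply: le_trans k1 _.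
    case: hi0 => [->|{}h0]; first by rewrite invr0 mulr0.
    by rewrite ler_pdivrMr// mulrC hB.
  exists (i, Ordinal kN) => /=; exists t; rewrite //= in_itv /= le_min tBi /=.
  case: hi0 => {}h0.
    by rewrite h0 mul0r in hB; rewrite h0 !mul0r; lra.
  by move: k1 k2; rewrite ler_pdivlMr// ltr_pdivrMr// ![_ * h i]mulrC => -> /ltW ->.
Qed.

(** The family consists of [m] arcs. A connected set of diameter larger than
    [e] has [m + 1] points at mutual distances at least [e / m], two of which
    lie on the same arc; it contains the arc between them, whose parameters
    spread over more than one cell of a fine enough subdivision. *)
Lemma connected_meets_grid (e : R) : 0 < e ->
  exists (J : finType) (G : J -> T), forall K x y, connected K -> K x -> K y ->
    e < mdist x y -> exists j, K (G j).
Proof.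
move=> e0; pose eta := e / m%:R.
have [m0|m0] := posnP m.
  exists 'I_m, (fun i => F i 0) => K x y.
  by have [i] := F_cover x; have := ltn_ord i; rewrite {2}m0.
have mR : (0 : R) < m%:R by rewrite ltr0n.
have eta0 : 0 < eta by rewrite divr_gt0.
have [N N0 hN] := uniform_mesh eta0.
have NR : (0 : R) < N%:R by rewrite ltr0n.
pose h i := B i / N%:R.
exists ('I_m * 'I_N.+1)%type, (fun j : 'I_m * 'I_N.+1 => F j.1 (h j.1 * j.2%:R)).
move=> K x y cK Kx Ky exy.
(* One point of K on each sphere of radius k * eta around x. *)
have /choice[z zP] : forall k : 'I_m.+1, exists z, K z /\ mdist x z = eta * k%:R.
  move=> k; have [|z Kz zE] := @connected_mdist_ivt _ _ K x y (eta * k%:R) cK Kx Ky.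
    rewrite mulr_ge0 ?(ltW eta0)//= (le_trans _ (ltW exy))//.
    by rewrite mulrAC ler_pdivrMr// ler_pM2l// ler_nat -ltnS.
  by exists z.
have /choice[it itP] : forall k : 'I_m.+1, exists it : 'I_m * R,
    it.2 \in `[0, B it.1] /\ F it.1 it.2 = z k.
  by move=> k; have [i [t tB zE]] := F_cover (z k); exists (i, t).
have [k [l [kl ikl]]] : exists k l, k != l /\ (it k).1 = (it l).1.
  have : ~ injective (fun k => (it k).1).
    by move=> /leq_card; rewrite !card_ord ltnn.
  move=> ninj; apply: contrapT => nkl; apply: ninj => k l ikl.
  by apply/eqP; apply: contrapT => /negP kl; apply: nkl; exists k, l.
have zkl : eta <= mdist (z k) (z l).
  apply: le_trans (mdist_ldist x _ _).
  rewrite (zP k).2 (zP l).2 -mulrBr normrM gtr0_norm//.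
  apply: ler_peMr; first exact: ltW.
  have [kl'|kl'|/val_inj/eqP] := ltngtP k l; last by rewrite (negbTE kl).
    have : (k.+1%:R : R) <= l%:R by rewrite ler_nat.
    by rewrite -natr1 ler_normr; lra.
  have : (l.+1%:R : R) <= k%:R by rewrite ler_nat.
  by rewrite -natr1 ler_normr; lra.
have [[i s] [t [sB tB Ks Kt st]]] : exists (it : 'I_m * R) t,
   [/\ it.2 \in `[0, B it.1], t \in `[0, B it.1], K (F it.1 it.2), K (F it.1 t) &
     h it.1 < t - it.2].
  have [kB kE] := itP k; have [lB lE] := itP l; rewrite -ikl in lB lE.
  have Kk := (zP k).1; have Kl := (zP l).1.
  have : h (it k).1 < `|(it k).2 - (it l).2|.
    rewrite ltNge; apply/negP => /hN; rewrite kE lE => /(_ kB).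
    by rewrite ltNge zkl.
  case: (lerP (it k).2 (it l).2) => _ hlt.
    by exists (it k), (it l).2; rewrite /= kE lE; split.
  by exists ((it k).1, (it l).2), (it k).2; rewrite /= kE lE; split.
rewrite /= in sB tB Ks Kt st.
move: (sB) (tB); rewrite !in_itv /= => /andP[s0 sBi] /andP[t0 tBi].
have h0 : 0 < h i.
  rewrite divr_gt0// lt_neqAle B_ge0 andbT; apply/eqP => Bi.
  by move: st; rewrite /h -Bi mul0r; lra.
have hB : h i * N%:R = B i by rewrite divfK// gt_eqF.
have /andP[] := Num.Theory.truncn_itv (divr_ge0 s0 (ltW h0)).
rewrite ler_pdivlMr// ltr_pdivrMr// ![_ * h i]mulrC => k1 k2.
have kt : h i * (Num.truncn (s / h i)).+1%:R < t.
  by move: k1 st; rewrite -natr1 mulrDr mulr1; lra.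
have kN : ((Num.truncn (s / h i)).+1 < N.+1)%N.
  by rewrite ltnS -(ler_nat R) -(ler_pM2l h0) hB; lra.
exists (i, Ordinal kN) => /=.
apply: (connected_seg cK Ks Kt).
have -> : seg (F i s) (F i t) = F i @` `[s, t].
  by apply: (seg_subparam uT (@F_continuous i) (@F_inj i)); lra.
by eexists; last reflexivity; rewrite /= in_itv /=; lra.
Qed.

Context (x0 : T) (f : T -> T) (f_continuous : continuous f).
Context (J : finType) (q : T -> J) (e : R).
Context (e_ge0 : 0 <= e) (q_close : forall x y, q x = q y -> mdist x y <= e).

(** ** Orbits of connected sets *)

(** Each of the [m * 2] arms from [c] contributes the count of a chain. *)
Lemma star_codable n c : codable [set K | connected K /\ K c]
  (traj_close f n e) ((n * #|J|).+1 ^ (m * 2)).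
Proof.
pose arm (i : 'I_m * bool) := seg c (F i.1 (if i.2 then B i.1 else 0)).
have armE K : K = \bigcup_i (K `&` arm i).
  rewrite -setI_bigcupr; apply/seteqP; split => x; last by case.
  by move=> Kx; split => //; have [i] := star_cover c x; exists i.
have arm_codable i : codable [set K | connected K /\ K c]
    (fun K L => traj_close f n e (K `&` arm i) (L `&` arm i)) (n * #|J|).+1.
  have := chain_codable f e_ge0 q_close n.
  move=> /(_ ((fun K => K `&` arm i) @` [set K | connected K /\ K c])) chc.
  apply: codable_sub (codable_preimage (fun K => K `&` arm i) (chc _)) => //.
    by move=> K [cK Kc]; exists K.
  move=> _ _ [K [cK Kc] <-] [L [cL Lc] <-].
  have [h|h] := seg_initial_total (F i.1 (if i.2 then B i.1 else 0)) cK cL Kc Lc;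
    [left|right] => x xKs; split; [exact: h|exact: xKs.2|exact: h|exact: xKs.2].
have := codable_forall arm_codable; rewrite card_prod card_ord card_bool.
apply: codable_sub => // K L _ _ h j jn; rewrite (armE K) (armE L).
by apply: hausdorff_boundU => // i; exact: h.
Qed.

Lemma grid_codable n (I : finType) (G : I -> T) : codable connected
  (fun K L => forall i, K (G i) -> traj_close f n e K L)
  (((n * #|J|).+1 ^ (m * 2)).+1 ^ #|I|).
Proof.
apply: codable_forall => i; apply: (@codable_imply _ [set K | K (G i)]).
exact: star_codable.
Qed.

(** The code of [K] records the first time at which the image of [K] has
    diameter larger than [e], one of [s] codes for a point of [K], and the code
    of the image at that time as a connected set through a point of [G]. Before
    that time the images of two sets with the same code are at distance at most
    [e + 2 * e] through the orbits of their points; from then on the last code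
    applies. *)
Lemma connected_codable (I : finType) (G : I -> T) n s :
  (forall K x y, connected K -> K x -> K y -> e < mdist x y -> exists i, K (G i)) ->
  codable [set: T] (fun x y => forall j, (j < n)%N ->
    mdist (iter j f x) (iter j f y) <= 2 * e) s ->
  codable [set K | connected K /\ K !=set0] (traj_close f n (4 * e))
    (n.+1 * s * ((n * #|J|).+1 ^ (m * 2)).+1 ^ #|I|).
Proof.
move=> Ghit [pc pcP]; have [w wP] := grid_codable n G.
pose big (A : set T) := exists x y, [/\ A x, A y & e < mdist x y].
pose bigat K j := `[< big (iter j f @` K) >].
pose fst_big K := find (bigat K) (iota 0 n).
have fst_lt K : (fst_big K < n.+1)%N.
  by have := find_size (bigat K) (iota 0 n); rewrite size_iota ltnS.
pose code K := (Ordinal (fst_lt K), pc (xget x0 K), w (iter (fst_big K) f @` K)).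
apply: (@codable_finType _ _ code); last first.
  by rewrite !card_prod !card_ord.
have small K i x y : (i < fst_big K)%N -> (i < n)%N -> K x -> K y ->
    mdist (iter i f x) (iter i f y) <= e.
  move=> iK iN Kx Ky; rewrite leNgt; apply/negP => bigxy.
  have := before_find 0%N iK; rewrite (nth_iota 0%N) // add0n /bigat.
  move=> /negbT/asboolPn; apply.
  by exists (iter i f x), (iter i f y); split.
move=> K L [cK K0] [cL L0] [kl pcKL wKL] i iN.
have Kp : K (xget x0 K) by apply: xgetPex.
have Lp : L (xget x0 L) by apply: xgetPex.
have pd := pcP _ _ Logic.I Logic.I pcKL i iN.
have [iK|Ki] := ltnP i (fst_big K).
  split; first by rewrite mulr_ge0.
    move=> _ [x Kx <-]; exists (iter i f (xget x0 L)); first by exists (xget x0 L).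
    apply: le_trans (metric_triangle _ (iter i f (xget x0 K)) _) _.
    by have := small K i x (xget x0 K) iK iN Kx Kp; move: e_ge0; lra.
  move=> _ [x Lx <-]; exists (iter i f (xget x0 K)); first by exists (xget x0 K).
  apply: le_trans (metric_triangle _ (iter i f (xget x0 L)) _) _.
  rewrite kl in iK.
  by have := small L i (xget x0 L) x iK iN Lp Lx; move: e_ge0; lra.
have kN : (fst_big K < n)%N by exact: leq_ltn_trans iN.
have : bigat K (fst_big K).
  have : has (bigat K) (iota 0 n) by rewrite has_find size_iota.
  by move/(nth_find 0%N); rewrite nth_iota// add0n.
move=> /asboolP[x [y [Kx Ky exy]]].
have cc j A : connected A -> connected (iter j f @` A).
  move=> cA; apply: connected_continuous_connected => //.
  by apply: continuous_subspaceT; exact: iter_continuous.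
have [g Kg] := Ghit _ x y (cc (fst_big K) _ cK) Kx Ky exy.
rewrite -(subnK Ki) !image_iterD.
have := wP _ _ (cc _ _ cK) (cc _ _ cL) wKL g Kg; rewrite -kl => /(_ (i - fst_big K)%N).
case; first by apply: leq_ltn_trans iN; exact: leq_subr.
move=> _ h1 h2; split; first by rewrite mulr_ge0.
  by move=> a /h1[b Lb ab]; exists b => //; move: e_ge0; lra.
by move=> a /h2[b Lb ab]; exists b => //; move: e_ge0; lra.
Qed.

(** A graph over a small piece [P] is close to the product of [P] with the
    image of [P]. *)
Lemma graph_codable (I : finType) (P : I -> set T) n N :
  (forall i, connected (P i) /\ P i !=set0) ->
  (forall i x y, P i x -> P i y -> mdist x y <= e) ->
  (forall x, exists i, P i x) ->
  codable [set K | connected K /\ K !=set0] (traj_close f n (4 * e)) N ->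
  codable [set phi : T -> T | continuous phi]
    (fun phi psi => forall j, (j < n)%N ->
      hausdorff_bound (map_graph (iter j f \o phi)) (map_graph (iter j f \o psi))
        (4 * e)) (N ^ #|I|).
Proof.
move=> cP dP covP cN.
have piece i : codable [set phi : T -> T | continuous phi]
    (fun phi psi => traj_close f n (4 * e) (phi @` P i) (psi @` P i)) N.
  apply: codable_sub (codable_preimage (fun phi : T -> T => phi @` P i) cN) => //.
  move=> phi cphi; have [cPi [x Px]] := cP i; split; last by exists (phi x), x.
  apply: connected_continuous_connected => //; exact: continuous_subspaceT.
apply: codable_sub (codable_forall piece) => // phi psi cphi cpsi h j jn.
have pair_le i x y : P i x -> P i y -> forall a b : T, mdist a b <= 4 * e ->
    mdist (x, a) (y, b) <= 4 * e.
  move=> Px Py a b ab; rewrite /mdist /= /mdist_max ge_max ab andbT /=.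
  by have := dP i x y Px Py; move: e_ge0; lra.
split; first by rewrite mulr_ge0.
- move=> [x a]; rewrite {1}/map_graph /= => ->.
  have [i Px] := covP x; have [_ + _] := h i j jn.
  move=> /(_ (iter j f (phi x)))[|_ [_ [y Py <-] <-] xy].
    by exists (phi x) => //; exists x.
  by exists (y, iter j f (psi y)) => //; exact: pair_le Px Py _ _ xy.
- move=> [x a]; rewrite {1}/map_graph /= => ->.
  have [i Px] := covP x; have [_ _] := h i j jn.
  move=> /(_ (iter j f (psi x)))[|_ [_ [y Py <-] <-] xy].
    by exists (psi x) => //; exists x.
  exists (y, iter j f (phi y)) => //; exact: pair_le Py Px _ _ xy.
Qed.

End finite_union_of_arcs.

(** * Subexponential growth and separated sets *)

Section subexponential.
Context (R : realType).

Definition subexp (u : nat -> nat) : Prop :=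
  forall eta : R, 0 < eta -> \forall n \near \oo, (u n)%:R <= expR (eta * n%:R).

Lemma subexp_le u v : (forall n, (u n <= v n)%N) -> subexp v -> subexp u.
Proof.
move=> uv sv eta /sv; apply: filterS => n; apply: le_trans.
by rewrite ler_nat.
Qed.

Lemma subexp_cst c : subexp (fun=> c).
Proof.
move=> eta eta0; near=> n; apply: le_trans (expR_ge1Dx _).
suff : c%:R <= eta * n%:R by lra.
rewrite mulrC -ler_pdivrMr//; near: n; exact: nbhs_infty_ger.
Unshelve. all: by end_near. Qed.

Lemma subexp_mul u v : subexp u -> subexp v -> subexp (fun n => u n * v n)%N.
Proof.
move=> su sv eta eta0; have eta20 : 0 < eta / 2 by rewrite divr_gt0.
near=> n; rewrite natrM (splitr eta) mulrDl expRD; apply: ler_pM => //.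
  by near: n; exact: su.
by near: n; exact: sv.
Unshelve. all: by end_near. Qed.

Lemma subexp_exp u k : subexp u -> subexp (fun n => u n ^ k)%N.
Proof.
move=> su; elim: k => [|k IH]; first exact: subexp_cst.
by apply: subexp_le (subexp_mul su IH) => n; rewrite expnS.
Qed.

Lemma subexp_succ : subexp S.
Proof.
move=> eta eta0; have eta20 : 0 < eta / 2 by rewrite divr_gt0.
near=> n; rewrite (splitr eta) mulrDl expRD -natr1.
have h : 1 + eta / 2 * n%:R <= expR (eta / 2 * n%:R) by exact: expR_ge1Dx.
(* (1 + x) ^ 2 >= n + 1 with x = eta n / 2, as soon as x ^ 2 >= n *)
have hn : 4 / (eta * eta) <= n%:R by near: n; exact: nbhs_infty_ger.
have n0 : 0 <= n%:R :> R by [].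
have hn' : 4 <= n%:R * (eta * eta) by rewrite -ler_pdivrMr// mulr_gt0.
apply: le_trans (_ : (1 + eta / 2 * n%:R) * (1 + eta / 2 * n%:R) <= _).
  nra.
by apply: ler_pM => //; nra.
Unshelve. all: by end_near. Qed.

End subexponential.

Lemma counting_seq (R : realType) (X : choiceType) (s : seq X) : uniq s ->
  counting [set` s] = (size s)%:R%:E :> \bar R.
Proof.
move=> us; rewrite /counting; case: asboolP => [fs|]; last by case; exact: finite_seq.
congr (_%:R%:E); apply: perm_size; apply: uniq_perm; [exact: finmap.fset_uniq|by []|].
by move=> x; rewrite in_fset_set//; apply/idP/idP; rewrite in_setE.
Qed.

Section separated_sets.
Context {R : realType} {X : metricType R} (g : X -> X).
Implicit Types (x y : X) (n : nat) (e : R).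

Lemma orbit_dist_leP n e x y : 0 <= e -> orbit_dist n g x y <= e <->
  forall j, (j < n)%N -> mdist (iter j g x) (iter j g y) <= e.
Proof.
move=> e0; split=> [/bigmax_leP[_ h] j jn|h]; first exact: (h (Ordinal jn)).
by apply/bigmax_leP; split => // j _; exact: h.
Qed.

Lemma orbit_dist_sym n x y : orbit_dist n g x y = orbit_dist n g y x.
Proof. by apply: eq_bigr => j _; exact: metric_sym. Qed.

Lemma counting_le_codable n e E N :
  codable [set: X] (fun x y => orbit_dist n g x y <= e) N ->
  Defs.separated n g e E -> (counting E <= N%:R%:E :> \bar R)%E.
Proof.
move=> [c cP] sE.
have injc : {in E &, injective c}.
  move=> x y /set_mem Ex /set_mem Ey cxy; apply: contrapT => xy.
  by have := sE _ _ Ex Ey xy; rewrite ltNge cP.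
have fE : finite_set E.
  by rewrite -(eq_finite_set (inj_card_eq injc)); exact: finite_finset.
rewrite /counting asboolT// lee_fin ler_nat -[leqRHS]card_ord.
rewrite -(size_map c).
have /card_uniqP <- : uniq (map c (finmap.enum_fset (fset_set E))).
  rewrite map_inj_in_uniq ?finmap.fset_uniq// => x y.
  by rewrite !in_fset_set//; exact: injc.
exact: max_card.
Qed.

Lemma sep_le_codable n e N :
  codable [set: X] (fun x y => orbit_dist n g x y <= e) N ->
  (sep n g e <= N%:R%:E)%E.
Proof.
by move=> cN; apply: ge_ereal_sup => _ [E sE <-]; exact: counting_le_codable sE.
Qed.

Lemma sep_seq_ge n e s : uniq s -> Defs.separated n g e [set` s] ->
  ((size s)%:R%:E <= sep n g e)%E.
Proof.
by move=> us ss; apply: ereal_sup_ubound; exists [set` s] => //; exact: counting_seq.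
Qed.

Lemma sep_ge1 n e x : (1 <= sep n g e)%E.
Proof.
apply: (@sep_seq_ge n e [:: x]) => // y z /=; rewrite !inE => /eqP -> /eqP ->.
by [].
Qed.

(** The codes bound the size of separated sets, so there is a largest one; by
    maximality it spans at the same scale. *)
Lemma sep_attained n e N x0 : 0 <= e ->
  codable [set: X] (fun x y => orbit_dist n g x y <= e) N ->
  exists s : seq X, [/\ (0 < size s)%N, uniq s, Defs.separated n g e [set` s],
    sep n g e = (size s)%:R%:E &
    forall x, exists2 y, y \in s & orbit_dist n g x y <= e].
Proof.
move=> e0 cN.
pose Q k := `[< exists s : seq X,
  [/\ size s = k, uniq s & Defs.separated n g e [set` s]] >].
have Q1 : Q 1%N.
  apply/asboolP; exists [:: x0]; split => // y z /=.
  by rewrite !inE => /eqP -> /eqP ->.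
have QN k : Q k -> (k <= N)%N.
  move=> /asboolP[s [<- us ss]]; rewrite -(ler_nat R) -lee_fin.
  by rewrite -counting_seq//; exact: counting_le_codable ss.
have [k /asboolP[s [sk us ss]] kmax] := ex_maxnP (ex_intro (fun k => Q k) 1%N Q1) QN.
exists s; split => //.
- by rewrite sk; exact: kmax.
- apply/eqP; rewrite eq_le sep_seq_ge// andbT.
  apply: ge_ereal_sup => _ [E sE <-]; have := counting_le_codable cN sE.
  rewrite /counting; case: asboolP => // fE _.
  rewrite lee_fin ler_nat sk; apply: kmax; apply/asboolP.
  exists (finmap.enum_fset (fset_set E)); split => //; first exact: finmap.fset_uniq.
  by move=> x y /=; rewrite !in_fset_set// !inE; exact: sE.
- move=> x; apply: contrapT => nx.
  have far y : y \in s -> e < orbit_dist n g x y.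
    by move=> ys; rewrite ltNge; apply/negP => h; apply: nx; exists y.
  have xs : x \notin s.
    apply/negP => xs; have := far x xs; rewrite ltNge.
    suff -> : orbit_dist n g x x <= e by [].
    by apply/orbit_dist_leP => // j _; rewrite mdistxx.
  have /kmax : Q k.+1.
    apply/asboolP; exists (x :: s); rewrite /= xs sk; split => // y z.
    rewrite /= !inE => /orP[/eqP ->|ys] /orP[/eqP ->|zs] // yz.
    - exact: far.
    - by rewrite orbit_dist_sym; exact: far.
    - exact: ss.
  by rewrite ltnn.
Qed.

Lemma orbit_codable n e (J : finType) (q : X -> J) : 0 <= e ->
  (forall x y, q x = q y -> mdist x y <= e) ->
  codable [set: X] (fun x y => orbit_dist n g x y <= e) (#|J| ^ n).
Proof.
move=> e0 qP.
have cj (j : 'I_n) : codable [set: X]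
    (fun x y => mdist (iter j g x) (iter j g y) <= e) #|J|.
  apply: (codable_finType (c := fun x => q (iter j g x))) => // x y _ _.
  exact: qP.
have := codable_forall cj; rewrite card_ord.
apply: codable_sub => // x y _ _ h.
by apply/orbit_dist_leP => // j jn; exact: (h (Ordinal jn)).
Qed.

Lemma point_codable n e N x0 : 0 <= e ->
  codable [set: X] (fun x y => orbit_dist n g x y <= e) N ->
  exists s, [/\ (0 < s)%N, sep n g e = s%:R%:E &
    codable [set: X] (fun x y => forall j, (j < n)%N ->
      mdist (iter j g x) (iter j g y) <= 2 * e) s].
Proof.
move=> e0 cN.
have [s [s0 us ss sE cov]] := sep_attained x0 e0 cN.
exists (size s); split => //.
have /choice[h hP] : forall x, exists i : 'I_(size s),
    orbit_dist n g x (nth x0 s i) <= e.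
  move=> x; have [y ys xy] := cov x.
  have ys' : (index y s < size s)%N by rewrite index_mem.
  by exists (Ordinal ys'); rewrite /= nth_index.
exists h => x y _ _ hxy j jn.
have /orbit_dist_leP - /(_ e0 j jn) dx := hP x.
have /orbit_dist_leP - /(_ e0 j jn) dy := hP y.
rewrite hxy in dx; rewrite metric_sym in dy.
by apply: le_trans (metric_triangle _ (iter j g (nth x0 s (h y))) _) _; lra.
Qed.

End separated_sets.

(** * Entropy as a growth rate *)

Section entropy_rate.
Context {R : realType} {X : metricType R} (g : X -> X).

Definition entropy_term e n : \bar R := ((n%:R^-1)%:E * lne (sep n g e))%E.

Lemma entropy_term_nat e n a : (0 < a)%N -> sep n g e = a%:R%:E ->
  entropy_term e n = (n%:R^-1 * ln a%:R)%:E.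
Proof. by move=> a0 aE; rewrite /entropy_term aE lne_EFin// ltr0n. Qed.

Lemma entropy_rate_le e e' : e <= e' ->
  (limn_esup (entropy_term e') <= limn_esup (entropy_term e))%E.
Proof.
move=> ee'; apply: le_ereal_inf_tmp => _ [V FV <-].
apply: le_trans (ereal_inf_lbound _) _; first by exists V.
apply: ge_ereal_sup => _ [n Vn <-]; apply: le_ereal_sup_tmp.
exists (entropy_term e n); first by exists n.
apply: lee_wpmul2l; first by rewrite lee_fin.
by rewrite lee_lne ?le_sep// in_itv /= sep_ge0 leey.
Qed.

(** The rate increases as the scale decreases, so each rate is below the limit. *)
Lemma entropy_rate_le_entropy e : 0 < e ->
  (limn_esup (entropy_term e) <= topological_entropy g)%E.
Proof.
move=> e0; apply: lime_ge; first exact: topological_entropy_is_cvg.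
near=> e'; apply: entropy_rate_le; near: e'; exact: nbhs_right_le.
Unshelve. all: by end_near. Qed.

Lemma topological_entropy_le h :
  (forall e, 0 < e -> (limn_esup (entropy_term e) <= h)%E) ->
  (topological_entropy g <= h)%E.
Proof.
move=> gh; apply: lime_le; first exact: topological_entropy_is_cvg.
by near=> e; apply: gh; near: e; exact: nbhs_right_gt.
Unshelve. all: by end_near. Qed.

Lemma topological_entropy_ge h (d : R) : 0 < d ->
  (forall e, 0 < e -> e < d -> (h <= limn_esup (entropy_term e))%E) ->
  (h <= topological_entropy g)%E.
Proof.
move=> d0 gh; apply: lime_ge; first exact: topological_entropy_is_cvg.
near=> e; apply: gh; near: e; [exact: nbhs_right_gt|exact: nbhs_right_lt].
Unshelve. all: by end_near. Qed.

Lemma topological_entropy_ge0 (x0 : X) : (0 <= topological_entropy g)%E.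
Proof.
apply: (topological_entropy_ge ltr01) => e _ _.
apply: le_ereal_inf_tmp => _ [V FV <-].
have [n Vn] := filter_ex FV.
apply: le_ereal_sup_tmp; exists (entropy_term e n); first by exists n.
by rewrite mule_ge0// ?lee_fin// lne_ge0 (sep_ge1 _ _ _ x0).
Qed.

Lemma entropy0_subexp e u : 0 < e -> topological_entropy g = 0%E ->
  (forall n, (0 < u n)%N) -> (forall n, sep n g e = (u n)%:R%:E) -> subexp R u.
Proof.
move=> e0 h0 u0 uE eta eta0.
have : (limn_esup (entropy_term e) < eta%:E)%E.
  by apply: le_lt_trans (entropy_rate_le_entropy e0) _; rewrite h0 lte_fin.
move=> /ereal_inf_lt[_ [V FV <-] Veta].
near=> n.
have n0 : 0 < n%:R :> R by rewrite ltr0n; near: n; exact: nbhs_infty_gt.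
have : (entropy_term e n < eta%:E)%E.
  by apply: le_lt_trans Veta; apply: ereal_sup_ubound; exists n => //; near: n.
rewrite (entropy_term_nat (u0 n) (uE n)) lte_fin ltr_pdivrMl// mulrC => lneta.
by rewrite -[leLHS]lnK ?posrE ?ltr0n// ler_expR ltW.
Unshelve. all: by end_near. Qed.

Lemma subexp_entropy0 : X ->
  (forall e, 0 < e -> exists2 u, subexp R u &
     forall n, (sep n g e <= (u n)%:R%:E)%E) ->
  topological_entropy g = 0%E.
Proof.
move=> x0 gu; apply/eqP; rewrite eq_le topological_entropy_ge0// andbT.
apply: topological_entropy_le => e /gu[u su uE].
apply/lee_addgt0Pr => eta eta0; rewrite add0e.
apply: le_trans (ereal_inf_lbound _) _.
  by exists [set n | (u n)%:R <= expR (eta * n%:R)] => //; exact: su.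
apply: ge_ereal_sup => _ [n /= un <-].
have [->|n0] := posnP n; first by rewrite /entropy_term invr0 mul0e lee_fin ltW.
rewrite lee_pdivrMl ?ltr0n// -EFinM.
have -> : (n%:R * eta)%:E = lne (expR (eta * n%:R))%:E.
  by rewrite lne_EFin ?expR_gt0// expRK mulrC.
rewrite lee_lne ?in_itv /= ?leey ?andbT ?sep_ge0 ?lee_fin ?expR_ge0//.
by apply: le_trans (uE n) _; rewrite lee_fin.
Qed.

End entropy_rate.

(** Every rate of [G] at a small scale is at least [k] times the rate of [g] at
    one fixed scale where the latter is positive; the scale of [G] may depend on
    [k], which tends to infinity. *)
Lemma entropy_pinfty (R : realType) (X Y : metricType R) (g : X -> X) (G : Y -> Y) :
  (forall e n, 0 < e -> exists2 a, (0 < a)%N & sep n g e = a%:R%:E) ->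
  (forall k e, 0 < e -> exists2 d, 0 < d & forall e' n a, 0 < e' -> e' < d ->
     sep n g e = a%:R%:E -> ((a ^ k)%:R%:E <= sep n G e')%E) ->
  (0 < topological_entropy g)%E -> topological_entropy G = +oo%E.
Proof.
move=> sepg sepG hg.
have [e e0 ge] : exists2 e, 0 < e & (0 < limn_esup (entropy_term g e))%E.
  apply: contrapT => ng; move: hg; rewrite ltNge => /negP; apply.
  apply: topological_entropy_le => e e0; rewrite leNgt; apply/negP => he.
  by apply: ng; exists e.
have [c c0 cg] : exists2 c : R, 0 < c & (c%:E < limn_esup (entropy_term g e))%E.
  case: (limn_esup _) ge => [r| |//].
    by rewrite lte_fin => r0; exists (r / 2); rewrite ?lte_fin ?divr_gt0//; lra.
  by move=> _; exists 1 => //; exact: ltey.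
apply/eqyP => A A0; pose k := (Num.truncn (A / c)).+1.
have kcA : A <= k%:R * c.
  by rewrite -ler_pdivrMr// ltW// Num.Theory.truncnS_gt.
apply: le_trans (_ : ((k%:R * c)%:E <= _)%E); first by rewrite lee_fin.
have [d d0 dG] := sepG k e e0.
apply: (topological_entropy_ge d0) => e' e'0 e'd.
apply: le_ereal_inf_tmp => _ [V FV <-].
have : (c%:E < ereal_sup [set entropy_term g e n | n in V])%E.
  by apply: lt_le_trans cg _; apply: ereal_inf_lbound; exists V.
move=> /ereal_sup_gt[_ [n Vn <-]] cn.
apply: le_ereal_sup_tmp; exists (entropy_term G e' n); first by exists n.
have [a a0 aE] := sepg e n e0.
have aG := dG e' n a e'0 e'd aE.
have ak0 : (0 : R) < (a ^ k)%:R by rewrite ltr0n expn_gt0 a0.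
apply: (@le_trans _ _ ((n%:R^-1)%:E * lne ((a ^ k)%:R%:E))%E); last first.
  apply: lee_wpmul2l; first by rewrite lee_fin.
  by rewrite lee_lne ?in_itv /= ?leey ?andbT ?sep_ge0 ?lee_fin// ltW.
rewrite lne_EFin// -EFinM lee_fin.
move: cn; rewrite (entropy_term_nat a0 aE) lte_fin => cn.
rewrite natrX lnXn ?ltr0n// -[ln _ *+ k]mulr_natl mulrCA.
by rewrite ler_wpM2l// ltW.
Qed.

(** * The envelope of a map with zero entropy *)

Section tree_parametrization.
Context {R : realType} {T : metricType R}.

Lemma tree_arcs : tree T -> exists (m : nat) (F : 'I_m -> R -> T) (B : 'I_m -> R),
  [/\ forall i, 0 <= B i, forall i, continuous (F i),
      forall i, {in `[0, B i] &, injective (F i)} &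
      forall x, exists i, exists2 t, t \in `[0, B i] & F i t = x].
Proof.
move=> [_ _ [[x xT]|[m [A [iA AT]]]]].
  exists 1%N, (fun _ => cst x), (fun _ => 0); split => //.
  - by move=> _ ?; exact: cvg_cst.
  - by move=> _ s t; rewrite !in_itv /= -!eq_le => /eqP <- /eqP <-.
  - move=> y; exists ord0, 0; first by rewrite in_itv /= lexx.
    by have : [set: T] y by []; rewrite xT.
have /choice[F FP] : forall i, exists f : R -> T,
    [/\ continuous f, {in `[0, 1] &, injective f} & A i = f @` `[0, 1]].
  move=> i; have [f [g hfg]] := iA i.
  have [h [ch ih _ _ Ah]] : exists h : R -> T, [/\ continuous h,
      {in `[0, 1] &, injective h}, h 0 = f 0, h 1 = f 1 & A i = h @` `[0, 1]].
    by apply: arc_between_ex; exists f, g.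
  by exists h.
exists m, F, (fun=> 1); split => // [i|i|x].
- by case: (FP i).
- by case: (FP i).
- have : [set: T] x by [].
  rewrite AT => -[i _]; have [_ _ ->] := FP i; move=> [t tI <-].
  by exists i; exists t.
Qed.

End tree_parametrization.

Section envelope_dynamics.
Context {R : realType} {T : metricType R} (hT : tree T).
Context (f : T -> T) (cf : continuous f).
Local Notation F := (envelope_map hT cf).
Implicit Types (K L : envelope_space hT) (phi : T -> T).

Lemma iter_envelope_graph n K phi : continuous phi ->
  hset (set_val K) = map_graph phi ->
  hset (set_val (iter n F K)) = map_graph (iter n f \o phi).
Proof.
move=> cphi Kphi; elim: n => [//|n IH].
have [_ FE] := envelope_mapP hT cf.
rewrite iterS (FE (iter n f \o phi))// => x.
by apply: continuous_comp; [exact: cphi|exact: iter_continuous].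
Qed.

(** Finitely many iterates of the extension are continuous, and the graphs of
    continuous maps are dense. *)
Lemma envelope_approx n K (e : R) : 0 < e -> exists L phi,
  [/\ continuous phi, hset (set_val L) = map_graph phi &
    forall j, (j < n)%N -> mdist (iter j F K) (iter j F L) <= e].
Proof.
move=> e0; have [cF _] := envelope_mapP hT cf.
have H (j : 'I_n) : \forall L \near K, mdist (iter j F K) (iter j F L) <= e.
  have : \forall L \near K, ball (iter j F K) e (iter j F L).
    exact: (iter_continuous cF) (nbhsx_ballx (iter j F K) _ e0).
  by apply: (@filterS _ _ (nbhs_filter K)) => L; rewrite ballEmdist; exact: ltW.
have := filter_forall (nbhs_filter K) H; move=> /nbhs_ballP[d /= d0 dK].
have [L [gL KL]] := set_valP K _ (nbhsx_ballx (set_val K) _ d0).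
have [phi cphi Lphi] := gL.
exists (exist _ L (mem_set (subset_closure gL))), phi; split => // j jn.
by apply: (dK _ _ (Ordinal jn)).
Qed.

Lemma envelope_codable n (e : R) N : 0 < e ->
  codable [set phi : T -> T | continuous phi]
    (fun phi psi => forall j, (j < n)%N ->
      hausdorff_bound (map_graph (iter j f \o phi)) (map_graph (iter j f \o psi))
        (4 * e)) N ->
  codable [set: envelope_space hT]
    (fun K L => orbit_dist n F K L <= 6 * e) N.
Proof.
move=> e0 cN.
have /choice[h hP] : forall K, exists Lphi : envelope_space hT * (T -> T),
  [/\ continuous Lphi.2, hset (set_val Lphi.1) = map_graph Lphi.2 &
    forall j, (j < n)%N -> mdist (iter j F K) (iter j F Lphi.1) <= e].
  by move=> K; have [L [phi hL]] := envelope_approx n K e0; exists (L, phi).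
apply: codable_sub (codable_preimage (fun K => (h K).2) cN).
  by move=> K _ /=; case: (hP K).
move=> K L _ _ /= hKL; apply/orbit_dist_leP => [|j jn].
  by rewrite mulr_ge0// ltW.
have [cK Kphi /(_ j jn) dK] := hP K; have [cL Lphi /(_ j jn) dL] := hP L.
have dKL : mdist (iter j F (h K).1) (iter j F (h L).1) <= 4 * e.
  apply: hausdorff_dist_le.
  by rewrite (iter_envelope_graph _ cK Kphi) (iter_envelope_graph _ cL Lphi); exact: hKL.
have := metric_triangle (iter j F K) (iter j F (h K).1) (iter j F L).
have := metric_triangle (iter j F (h K).1) (iter j F (h L).1) (iter j F L).
rewrite (metric_sym (iter j F (h L).1)); lra.
Qed.

Lemma envelope_entropy0 : topological_entropy f = 0%E ->
  topological_entropy F = 0%E.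
Proof.
move=> h0; have [[x0 _] uT _] := hT.
have [m [A [B [B0 cA iA covA]]]] := tree_arcs hT.
have ccst : continuous (cst x0 : T -> T) by move=> ?; exact: cvg_cst.
have [K0 gK0 _] := continuous_graphs_map hT ccst.
apply: subexp_entropy0; first exact: (exist _ K0 (mem_set (subset_closure gK0))).
move=> e e0; pose d := e / 6; have d0 : 0 < d by rewrite divr_gt0.
have [J [P [cP dP covP]]] := small_connected_cover B0 cA covA d0.
have [I [G GP]] := connected_meets_grid uT B0 cA iA covA d0.
have /choice[q qP] := covP.
have q_close x y : q x = q y -> mdist x y <= d.
  by move=> qxy; apply: (dP (q x)) => //; rewrite qxy.
have /choice[s sP] := fun n =>
  point_codable x0 (ltW d0) (orbit_codable f n (ltW d0) q_close).
pose w n := (((n * #|J|).+1 ^ (m * 2)).+1 ^ #|I|)%N.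
exists (fun n => (n.+1 * s n * w n) ^ #|J|)%N.
  apply/subexp_exp/subexp_mul; first apply: subexp_mul.
  - exact: subexp_succ.
  - apply: (entropy0_subexp d0 h0) => n; first by case: (sP n).
    by case: (sP n).
  - apply/subexp_exp.
    pose v n := (2 * (#|J|.+1 * n.+1) ^ (m * 2))%N.
    have sv : subexp R v.
      apply: subexp_mul; first exact: subexp_cst.
      by apply/subexp_exp/subexp_mul; [exact: subexp_cst|exact: subexp_succ].
    apply: subexp_le sv => n.
    apply: leq_trans (_ : 2 * (n * #|J|).+1 ^ (m * 2) <= _)%N.
      by rewrite mul2n -addnn -addn1 leq_add2l expn_gt0.
    have le1 : ((n * #|J|).+1 <= #|J|.+1 * n.+1)%N.
      by rewrite mulSn mulnS addSn ltnS mulnC; lia.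
    rewrite leq_mul2l /=.
    by have [->//|m2] := posnP (m * 2)%N; rewrite leq_exp2r.
move=> n; have [_ _ sn] := sP n.
apply: sep_le_codable.
have := connected_codable uT B0 cA iA covA x0 cf (ltW d0) q_close GP sn.
move=> /(graph_codable (ltW d0) cP dP covP) /(envelope_codable d0).
by apply: codable_sub => // K L _ _; rewrite /d mulrC divfK.
Qed.

End envelope_dynamics.

(** * The envelope of a map with positive entropy *)

Section platforms.
Context {R : realType} {T : metricType R} (uT : uniquely_arcwise_connected R T).
Implicit Types (x y : T).

Lemma path_ex x y : exists g : R -> T, [/\ continuous g,
  forall t, t <= 0 -> g t = x & forall t, 1 <= t -> g t = y].
Proof.
have [f [b [b0 cf _ fx fy]]] := seg_ex uT x y.
exists (fun t => f (clamp b (b * t))); split.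
- move=> t; apply: continuous_comp; last exact: cf.
  apply: continuous_comp; last exact: clamp_continuous.
  by apply: cvgM; [exact: cvg_cst|exact: cvg_id].
- move=> t t0; rewrite /clamp (_ : Num.max _ _ = 0)//.
  by apply/max_idPl; rewrite ge_min mulr_ge0_le0.
- move=> t t1; rewrite /clamp (_ : Num.max _ _ = b)//.
  rewrite (min_idPr _) ?(max_idPr _)//.
  by rewrite ler_peMr.
Qed.

(** The path stays at [y i] during the time interval of radius [1 / 3] around
    [i] and travels to the next point in the remaining third. *)
Lemma path_through (y : nat -> T) k : exists2 g : R -> T, continuous g &
  (forall i t, (i < k)%N -> `|t - i%:R| <= 1 / 3 -> g t = y i).
Proof.
elim: k => [|k [g cg gE]]; first by exists (cst (y 0%N)) => // ?; exact: cvg_cst.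
case: k => [|k] in g cg gE *.
  exists (cst (y 0%N)); first by move=> ?; exact: cvg_cst.
  by case.
have [p [cp p0 p1]] := path_ex (y k) (y k.+1).
exists (fun u => if u <= k%:R + 1 / 3 then g u else p (3 * (u - k%:R - 1 / 3))).
- apply: continuous_glue => //.
    move=> u; apply: continuous_comp; last exact: cp.
    apply: cvgM; first exact: cvg_cst.
    by apply: cvgB; [apply: cvgB; [exact: cvg_id|exact: cvg_cst]|exact: cvg_cst].
  rewrite p0; last lra.
  by apply: gE => //; rewrite ler_norml; lra.
- move=> i t; rewrite ltnS leq_eqVlt => /predU1P[->|ik] ti.
    move: ti; rewrite -natr1 ler_norml => ti.
    rewrite ifF; last by apply/negbTE; rewrite -ltNge; lra.
    by apply: p1; lra.
  have iR : i%:R <= k%:R :> R by rewrite ler_nat -ltnS.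
  rewrite ifT; first exact: gE.
  by move: ti; rewrite ler_norml; lra.
Qed.

(** The balls and their radius come first: the map is the composite of the
    fixed Lipschitz function [(k + 1) / D * mdist x0], which takes the values
    [0], ..., [k - 1] at the centres, with a path through the values. *)
Lemma platforms x0 x1 k : x0 <> x1 -> exists (p : 'I_k -> T) (d : R), 0 < d /\
  forall y : 'I_k -> T, exists2 phi : T -> T, continuous phi &
    forall i x, mdist (p i) x < d -> phi x = y i.
Proof.
move=> x01; pose D := mdist x0 x1.
have D0 : 0 < D by rewrite mdist_gt0; apply/eqP.
have k0 : 0 < k.+1%:R :> R by [].
have seg_conn : connected (seg x0 x1).
  have [f [b [b0 cf injf <- <-]]] := seg_ex uT x0 x1.
  rewrite seg_param//; apply: connected_continuous_connected.
    exact: segment_connected.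
  exact: continuous_subspaceT.
have /choice[p pP] : forall i : 'I_k, exists z, mdist x0 z = D / k.+1%:R * i%:R.
  move=> i; have [|z _ zE] := @connected_mdist_ivt _ _ _ x0 x1 (D / k.+1%:R * i%:R)
      seg_conn (seg_l _ _) (seg_r uT _ _).
    rewrite mulr_ge0 ?divr_ge0 ?(ltW D0)//= mulrAC ler_pdivrMr// ler_pM2l//.
    by rewrite ler_nat ltnW// ltnS ltnW.
  by exists z.
exists p, (D / k.+1%:R / 3); split; first by rewrite !divr_gt0.
move=> y.
have [k00|k00] := posnP k.
  exists id; first by move=> ?; exact: cvg_id.
  by move=> i; have := ltn_ord i; rewrite {2}k00.
have [g cg gE] := path_through (fun i => y (insubd (Ordinal k00) i)) k.
exists (fun x => g (k.+1%:R / D * mdist x0 x)).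
  move=> x; apply: continuous_comp; last exact: cg.
  apply: cvgM; [exact: cvg_cst|exact: mdist_continuous].
move=> i x px; rewrite (gE i)//; first by rewrite valKd.
have -> : i%:R = k.+1%:R / D * mdist x0 (p i).
  by rewrite pP; field; rewrite gt_eqF//= -natr1 in k0 *; rewrite gt_eqF.
rewrite -mulrBr normrM gtr0_norm ?divr_gt0//.
have := mdist_ldist x0 x (p i); rewrite (metric_sym x (p i)) => h.
rewrite -mulrA -ler_pdivlMl// mulrC -ler_pdivlMr ?invr_gt0// invrK.
apply: le_trans h _; apply/ltW/(lt_le_trans px).
rewrite le_eqVlt; apply/orP; left; apply/eqP; field.
by rewrite -natr1 in k0 *; rewrite gt_eqF.
Qed.

End platforms.

Section envelope_positive_entropy.
Context {R : realType} {T : metricType R} (hT : tree T).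
Context (f : T -> T) (cf : continuous f).
Local Notation F := (envelope_map hT cf).

Lemma sep_nat n (e : R) : 0 < e -> exists s : seq T,
  [/\ (0 < size s)%N, uniq s, Defs.separated n f e [set` s] &
    sep n f e = (size s)%:R%:E].
Proof.
move=> e0; have [[z0 _] uT _] := hT.
have [m [A [B [B0 cA iA covA]]]] := tree_arcs hT.
have [J [P [cP dP covP]]] := small_connected_cover B0 cA covA e0.
have /choice[q qP] := covP.
have q_close x y : q x = q y -> mdist x y <= e.
  by move=> qxy; apply: (dP (q x)) => //; rewrite qxy.
have [s [s0 us ss sE _]] :=
  sep_attained z0 (ltW e0) (orbit_codable f n (ltW e0) q_close).
by exists s.
Qed.

(** Words of length [k] in a separated set of [f] give maps with these values
    on the [k] balls. If the Hausdorff distance of two iterated graphs were less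
    than both the radius [d] and [e], the point over the centre of a ball where
    the values differ would be close to a point of the other graph that also
    lies over this ball. *)
Lemma sep_envelope_ge k (e : R) : 0 < e -> exists2 d, 0 < d &
  forall e' n a, 0 < e' -> e' < d -> sep n f e = a%:R%:E ->
    ((a ^ k)%:R%:E <= sep n F e')%E.
Proof.
move=> e0; have [[z0 _] uT _] := hT.
have graph phi : continuous phi -> exists K : envelope_space hT,
    hset (set_val K) = map_graph phi.
  move=> cphi; have [K gK KE] := continuous_graphs_map hT cphi.
  by exists (exist _ K (mem_set (subset_closure gK))).
have [[x0 [x1 x01]]|T1] := pselect (exists x0 x1 : T, x0 <> x1); last first.
  exists 1 => // e' n a _ _.
  have [s [s0 us _ ->]] := sep_nat n e0; case=> /eqP; rewrite eqr_nat => /eqP <-.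
  have -> : size s = 1%N.
    case: s us s0 => [//|x [//|y s]] /= /andP[].
    rewrite inE negb_or => /andP[/eqP xy _] _.
    by case: T1; exists x, y.
  have czero : continuous (cst z0 : T -> T) by move=> ?; exact: cvg_cst.
  by have [K0 _] := graph _ czero; rewrite exp1n; exact: (sep_ge1 F n e' K0).
have [p [d [d0 dP]]] := platforms uT k x01.
exists (Num.min d e); first by rewrite lt_min d0.
move=> e' n a e'0; rewrite lt_min => /andP[e'd e'e].
have [s [s0 us ss ->]] := sep_nat n e0; case=> /eqP; rewrite eqr_nat => /eqP sa.
rewrite -{}sa.
pose y (v : {ffun 'I_k -> 'I_(size s)}) i := nth z0 s (v i).
have /choice[K KP] : forall v, exists K : envelope_space hT, exists2 phi : T -> T,
    continuous phi & hset (set_val K) = map_graph phi /\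
      forall i x, mdist (p i) x < d -> phi x = y v i.
  move=> v; have [phi cphi phiE] := dP (y v).
  by have [K KE] := graph _ cphi; exists K, phi.
have Ksep v v' : v != v' -> e' < orbit_dist n F (K v) (K v').
  move=> vv'; have [i vi] : exists i, v i != v' i.
    apply: contrapT => nv; case/eqP: vv'; apply/ffunP => i.
    by apply/eqP; apply: contrapT => /negP vi; apply: nv; exists i.
  have yi : y v i <> y v' i.
    by move=> /eqP; rewrite nth_uniq// (inj_eq val_inj) (negbTE vi).
  have ys w : [set` s] (y w i) by rewrite /= mem_nth.
  have := ss _ _ (ys v) (ys v') yi; rewrite !ltNge => /negP nclose.
  apply/negP => /orbit_dist_leP - /(_ (ltW e'0)) close; apply: nclose.
  apply/orbit_dist_leP => [|j jn]; first exact: ltW.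
  have [phi cphi [Kphi phiE]] := KP v; have [psi cpsi [Kpsi psiE]] := KP v'.
  have : mdist (iter j F (K v)) (iter j F (K v')) < Num.min d e.
    by apply: le_lt_trans (close j jn) _; rewrite lt_min e'd.
  move=> /hyperspace_mdist_lt[r].
  rewrite (iter_envelope_graph _ _ cphi Kphi) (iter_envelope_graph _ _ cpsi Kpsi).
  move=> [r0 /(_ (p i, iter j f (phi (p i)))) h _]; rewrite lt_min => /andP[rd re].
  have [//|[x b]] := h; rewrite /map_graph /= => ->.
  rewrite /mdist /= /mdist_max /= ge_max => /andP[px].
  rewrite (phiE i) ?mdistxx// (psiE i) => [|]; last exact: le_lt_trans rd.
  by move=> /le_trans; apply; exact: ltW.
have injK : injective K.
  move=> v v' KE; apply/eqP; apply: contrapT => /negP /Ksep; rewrite KE ltNge.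
  by move=> /negP; apply; apply/orbit_dist_leP => [|j _]; rewrite ?mdistxx ltW.
have -> : (size s ^ k)%N = size (map K (enum {ffun 'I_k -> 'I_(size s)})).
  by rewrite size_map -cardE card_ffun !card_ord.
apply: sep_seq_ge; first by rewrite map_inj_uniq ?enum_uniq.
move=> _ _ /= /mapP[v _ ->] /mapP[v' _ ->] KK; apply: Ksep.
by apply/eqP => vv'; apply: KK; rewrite vv'.
Qed.

Lemma envelope_entropy_pinfty : (0 < topological_entropy f)%E ->
  topological_entropy F = +oo%E.
Proof.
apply: entropy_pinfty; last exact: sep_envelope_ge.
by move=> e n e0; have [s [s0 _ _ sE]] := sep_nat n e0; exists (size s).
Qed.

End envelope_positive_entropy.

Local Open Scope ereal_scope.

Theorem theorem5 (R : realType) (T : metricType R) (hT : tree T)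
    (f : T -> T) (cf : continuous f) :
  (topological_entropy f = 0 ->
     topological_entropy (envelope_map hT cf) = 0) /\
  (0 < topological_entropy f ->
     topological_entropy (envelope_map hT cf) = +oo).
Proof.
by split; [exact: envelope_entropy0|exact: envelope_entropy_pinfty].
Qed.
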